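(* Let $k$ be an infinite field and let $n$ be a positive integer such that $\operatorname{char} k \nmid n$ and $p^3 \mid n$ for some prime $p$. Then the universal division algebra $UD(k,n)$ over $k$ of degree $n$ is a noncrossed product, i.e. it is not a crossed product: it contains no maximal subfield that is Galois over the center of $UD(k,n)$.
   Context: Convention: if $\operatorname{char} k = 0$, the condition $\operatorname{char} k\nmid n$ holds automatically. Crossed products: let $F$ be a field and let $D$ be a (finite-dimensional) division algebra with center $F$. $D$ is called a crossed product if it contains a maximal subfield $K$ which is a Galois extension of $F$; if $\operatorname{Gal}(K/F)\cong G$, then $D$ is called a $G$-crossed product. A noncrossed product is a division algebra that is not a crossed product. The degree (= index) of $D$ is $\sqrt{\dim_F D}$. Universal division algebra: let $k$ be an infinite field, $n$ a positive integer, and fix an integer $m\ge 2$ (the number of generic matrices). Let $X=\{x_{ij}^{(s)} \mid 1\le i,j\le n,\ 1\le s\le m\}$ be a set of independent commuting variables, $k[X]$ the polynomial ring over $k$ in these variables, and $k(X)$ its field of fractions. The standard generic $n\times n$ matrices over $k$ are $\xi^{(s)}=[x_{ij}^{(s)}]\in M_n(k[X])\subseteq M_n(k(X))$, $1\le s\le m$. Let $B_n$ be the $k$-subalgebra of $M_n(k(X))$ generated by $\xi^{(1)},\dots,\xi^{(m)}$ (the generic matrix algebra of degree $n$ over $k$). $B_n$ is a (noncommutative) domain. Let $R$ be the center of $B_n$ (an integral domain) and $L_n$ the fraction field of $R$. Then $UD(k,n)=B_n\otimes_R L_n$, which is a division algebra of degree $n$ with center $L_n$. *)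

(* Defs.v *)
From HB Require Import structures.
From mathcomp Require Import all_boot all_order all_algebra all_field.
From mathcomp Require Import boolp classical_sets cardinality.
From mathcomp Require Import mpoly.

Set Implicit Arguments.
Unset Strict Implicit.
Unset Printing Implicit Defensive.

Import GRing.Theory.
Local Open Scope ring_scope.
Local Open Scope quotient_scope.

Section CrossedProduct.

Definition is_subfield (D : nzRingType) (S : D -> Prop) : Prop :=
  [/\ S 1,
      forall x y, S x -> S y -> S (x - y),
      forall x y, S x -> S y -> S (x * y),
      forall x y, S x -> S y -> x * y = y * x &
      forall x, S x -> x != 0 -> exists2 y, S y & x * y = 1].

Definition is_maximal_subfield (D : nzRingType) (S : D -> Prop) : Prop :=
  is_subfield S /\
  forall T : D -> Prop, is_subfield T ->
    (forall x, S x -> T x) -> forall x, T x -> S x.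

(* The subfields of D that contain F are the images of the F-algebra morphisms
   from field extensions of F into D; the base field F plays the role of the
   center of D.  A finite Galois extension of F is a normal one (this is
   splittingFieldType) that is separable. *)
Definition crossed_product (F : fieldType) (D : algType F) : Prop :=
  exists (K : splittingFieldType F) (f : {lrmorphism K -> D}),
    galois 1 {:K} /\ is_maximal_subfield (fun x => exists a, f a = x).

End CrossedProduct.

Section Center.

Variable B : nzRingType.

Definition central : {pred B} := fun x => `[< forall y, x * y = y * x >].

Lemma centralP x : reflect (forall y, x * y = y * x) (x \in central).
Proof. exact: asboolP. Qed.

Lemma central_subring : GRing.subring_closed central.
Proof.
split; first by apply/centralP => y; rewrite mul1r mulr1.
  move=> x y /centralP cx /centralP cy; apply/centralP => z.
  by rewrite mulrBl mulrBr cx cy.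
move=> x y /centralP cx /centralP cy; apply/centralP => z.
by rewrite -mulrA cy mulrA cx mulrA.
Qed.

HB.instance Definition _ := GRing.isSubringClosed.Build B central
  central_subring.

Record ring_center := RingCenter { center_val :> B; _ : center_val \in central }.

HB.instance Definition _ := [isSub for center_val].
HB.instance Definition _ := [Choice of ring_center by <:].
HB.instance Definition _ := [SubChoice_isSubNzRing of ring_center by <:].

Lemma center_comm (r : ring_center) (b : B) :
  center_val r * b = b * center_val r.
Proof. exact: (elimT (centralP (val r)) (valP r) b). Qed.

Lemma center_mulC : commutative (@GRing.mul ring_center).
Proof. by move=> x y; apply: val_inj; rewrite !rmorphM /= center_comm. Qed.

HB.instance Definition _ :=
  GRing.PzRing_hasCommutativeMul.Build ring_center center_mulC.

End Center.

(* The tensor product of B and L over the center of B, where L is an algebra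
   over the center of B through j.  Its elements are formal sums of tpure
   tensors, i.e. lists of pairs (b, l), up to the congruence generated by
   bilinearity and by balancedness over the center. *)
Section CentralTensor.

Variables (B : nzRingType) (L : comNzRingType).
Variable j : {rmorphism ring_center B -> L}.

Inductive tensor_eq : seq (B * L) -> seq (B * L) -> Prop :=
| Tperm s t : perm_eq s t -> tensor_eq s t
| Tsym s t : tensor_eq s t -> tensor_eq t s
| Ttrans t s u : tensor_eq s t -> tensor_eq t u -> tensor_eq s u
| Tcat s s' t : tensor_eq s s' -> tensor_eq (s ++ t) (s' ++ t)
| Tzero l : tensor_eq [:: (0, l)] [::]
| Taddl b b' l : tensor_eq [:: (b + b', l)] [:: (b, l); (b', l)]
| Taddr b l l' : tensor_eq [:: (b, l + l')] [:: (b, l); (b, l')]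
| Tbal b r l : tensor_eq [:: (b * center_val r, l)] [:: (b, j r * l)].

Definition tensor_eqb (s t : seq (B * L)) : bool := `[< tensor_eq s t >].

Lemma tensor_eqbP s t : reflect (tensor_eq s t) (tensor_eqb s t).
Proof. exact: asboolP. Qed.

Lemma Trefl s : tensor_eq s s. Proof. exact/Tperm/perm_refl. Qed.

Lemma tensor_eqb_refl : reflexive tensor_eqb.
Proof. by move=> s; apply/tensor_eqbP/Trefl. Qed.

Lemma tensor_eqb_sym s t : tensor_eqb s t = tensor_eqb t s.
Proof. by apply/tensor_eqbP/tensor_eqbP; apply: Tsym. Qed.

Lemma tensor_eqb_trans : transitive tensor_eqb.
Proof.
by move=> t s u /tensor_eqbP st /tensor_eqbP tu; apply/tensor_eqbP/(Ttrans st).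
Qed.

Canonical tensor_eqb_equiv :=
  EquivRel tensor_eqb tensor_eqb_refl tensor_eqb_sym tensor_eqb_trans.

Definition tensor := {eq_quot tensor_eqb}.

HB.instance Definition _ : EqQuotient _ tensor_eqb tensor :=
  EqQuotient.on tensor.
HB.instance Definition _ := Choice.on tensor.

Definition tclass (s : seq (B * L)) : tensor := \pi_tensor s.

Lemma tclass_eqP s t : tclass s = tclass t <-> tensor_eq s t.
Proof.
split; first by move/eqmodP => /= /tensor_eqbP.
by move=> st; apply/eqmodP; apply/tensor_eqbP.
Qed.

Lemma tclassW (P : tensor -> Prop) : (forall s, P (tclass s)) -> forall x, P x.
Proof. by move=> Ps x; rewrite -[x]reprK; apply: Ps. Qed.

Lemma repr_eq s : tensor_eq (repr (tclass s)) s.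
Proof. by apply/tclass_eqP; rewrite /tclass reprK. Qed.

Lemma Tcat2 s s' t t' :
  tensor_eq s s' -> tensor_eq t t' -> tensor_eq (s ++ t) (s' ++ t').
Proof.
move=> ss tt; apply: Ttrans (Tcat t ss) _.
apply: Ttrans (Tperm _) _; first by rewrite perm_catC.
by apply: Ttrans (Tcat s' tt) _; apply: Tperm; rewrite perm_catC.
Qed.

Definition tadd (x y : tensor) : tensor := tclass (repr x ++ repr y).

Lemma taddE s t : tadd (tclass s) (tclass t) = tclass (s ++ t).
Proof. by apply/tclass_eqP/Tcat2; apply: repr_eq. Qed.

Definition lopp (s : seq (B * L)) := [seq (- x.1, x.2) | x <- s].

Lemma Tscat s : tensor_eq (s ++ lopp s) [::].
Proof.
elim: s => [|[b l] s IH] /=; first exact: Trefl.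
apply: (Ttrans (t := [:: (b, l); (- b, l)] ++ (s ++ lopp s))).
  by apply: Tperm; rewrite /= perm_cons -cat1s perm_catCA.
apply: (@Tcat2 _ [::] _ [::]) IH.
by apply: Ttrans (Tsym (Taddl _ _ _)) _; rewrite subrr; apply: Tzero.
Qed.

Definition topp (x : tensor) : tensor := tclass (lopp (repr x)).

Lemma taddA : associative tadd.
Proof.
by elim/tclassW=> s; elim/tclassW=> t; elim/tclassW=> u; rewrite !taddE catA.
Qed.

Lemma taddC : commutative tadd.
Proof.
elim/tclassW=> s; elim/tclassW=> t; rewrite !taddE.
by apply/tclass_eqP/Tperm; rewrite perm_catC.
Qed.

Lemma tadd0 : left_id (tclass [::]) tadd.
Proof. by elim/tclassW=> s; rewrite taddE. Qed.

Lemma taddN : left_inverse (tclass [::]) topp tadd.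
Proof.
move=> x; rewrite taddC -{1}[x]reprK; rewrite /topp -/(tclass _) taddE.
exact/tclass_eqP/Tscat.
Qed.

HB.instance Definition _ :=
  GRing.isZmodule.Build tensor taddA taddC tadd0 taddN.

Lemma tclassD s t : tclass (s ++ t) = tclass s + tclass t.
Proof. by rewrite -taddE. Qed.

Definition tpure (b : B) (l : L) : tensor := tclass [:: (b, l)].

Lemma tclassE s : tclass s = \sum_(x <- s) tpure x.1 x.2.
Proof.
by elim: s => [|[b l] s IH]; rewrite ?big_nil // big_cons -IH -cat1s tclassD.
Qed.

Lemma tpureDl b b' l : tpure (b + b') l = tpure b l + tpure b' l.
Proof. by rewrite -tclassD; apply/tclass_eqP/Taddl. Qed.

Lemma tpureDr b l l' : tpure b (l + l') = tpure b l + tpure b l'.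
Proof. by rewrite -tclassD; apply/tclass_eqP/Taddr. Qed.

Lemma tpure_bal b r l : tpure (b * center_val r) l = tpure b (j r * l).
Proof. exact/tclass_eqP/Tbal. Qed.

Lemma tpure0l l : tpure 0 l = 0. Proof. exact/tclass_eqP/Tzero. Qed.

Lemma tpure0r b : tpure b 0 = 0.
Proof. by apply: (addrI (tpure b 0)); rewrite -tpureDr !addr0. Qed.

Section Lift.

Variables (A : zmodType) (g : B -> L -> A).
Hypothesis gDl : forall b b' l, g (b + b') l = g b l + g b' l.
Hypothesis gDr : forall b l l', g b (l + l') = g b l + g b l'.
Hypothesis g_bal : forall b r l, g (b * center_val r) l = g b (j r * l).

Definition tlift (x : tensor) : A := \sum_(y <- repr x) g y.1 y.2.

Fact tlift_sum s t : tensor_eq s t ->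
  \sum_(y <- s) g y.1 y.2 = \sum_(y <- t) g y.1 y.2.
Proof.
elim=> {s t} //=.
- by move=> s t; apply: perm_big.
- by move=> t s u _ -> _ ->.
- by move=> s s' t _ E; rewrite !big_cat E.
- move=> l; rewrite big_nil big_seq1 /=.
  by apply: (addrI (g 0 l)); rewrite -gDl !addr0.
- by move=> b b' l; rewrite !big_cons !big_nil /= !addr0 gDl.
- by move=> b b' l; rewrite !big_cons !big_nil /= !addr0 gDr.
by move=> b r l; rewrite !big_seq1 /= g_bal.
Qed.

Lemma tlift_class s : tlift (tclass s) = \sum_(y <- s) g y.1 y.2.
Proof. exact/tlift_sum/repr_eq. Qed.

Lemma tlift_pure b l : tlift (tpure b l) = g b l.
Proof. by rewrite tlift_class big_seq1. Qed.

Lemma tliftD x y : tlift (x + y) = tlift x + tlift y.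
Proof.
elim/tclassW: x => s; elim/tclassW: y => t.
by rewrite -tclassD !tlift_class big_cat.
Qed.

Lemma tlift0 : tlift 0 = 0.
Proof. by apply: (addrI (tlift 0)); rewrite -tliftD !addr0. Qed.

End Lift.

Lemma tensor_ind_add (P : tensor -> Prop) :
  P 0 -> (forall b l, P (tpure b l)) ->
  (forall x y, P x -> P y -> P (x + y)) -> forall x, P x.
Proof.
move=> P0 Pp PD; elim/tclassW => s; rewrite tclassE.
by elim/big_ind: _ => // -[b l] _.
Qed.

Definition lmulpure (b : B) (l : L) : tensor -> tensor :=
  tlift (fun b' l' => tpure (b * b') (l * l')).

Lemma lmulpure_pure b l b' l' :
  lmulpure b l (tpure b' l') = tpure (b * b') (l * l').
Proof.
rewrite /lmulpure tlift_pure //.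
- by move=> *; rewrite mulrDr tpureDl.
- by move=> *; rewrite mulrDr tpureDr.
by move=> *; rewrite mulrA tpure_bal mulrCA.
Qed.

Lemma lmulpureD b l x y :
  lmulpure b l (x + y) = lmulpure b l x + lmulpure b l y.
Proof.
rewrite /lmulpure tliftD //.
- by move=> *; rewrite mulrDr tpureDl.
- by move=> *; rewrite mulrDr tpureDr.
by move=> *; rewrite mulrA tpure_bal mulrCA.
Qed.

Lemma lmulpure0 b l : lmulpure b l 0 = 0.
Proof. by apply: (addrI (lmulpure b l 0)); rewrite -lmulpureD !addr0. Qed.

(* (b ⊗ l) * (b' ⊗ l') = (b * b') ⊗ (l * l') *)
Definition tmul (x y : tensor) : tensor :=
  tlift (fun b l => lmulpure b l y) x.

Fact tmul_gDl y b b' l :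
  lmulpure (b + b') l y = lmulpure b l y + lmulpure b' l y.
Proof.
elim/tensor_ind_add: y => [|b0 l0|x y IHx IHy].
- by rewrite !lmulpure0 addr0.
- by rewrite !lmulpure_pure mulrDl tpureDl.
by rewrite !lmulpureD IHx IHy addrACA.
Qed.

Fact tmul_gDr y b l l' :
  lmulpure b (l + l') y = lmulpure b l y + lmulpure b l' y.
Proof.
elim/tensor_ind_add: y => [|b0 l0|x y IHx IHy].
- by rewrite !lmulpure0 addr0.
- by rewrite !lmulpure_pure mulrDl tpureDr.
by rewrite !lmulpureD IHx IHy addrACA.
Qed.

Fact tmul_gbal y b r l : lmulpure (b * center_val r) l y = lmulpure b (j r * l) y.
Proof.
elim/tensor_ind_add: y => [|b0 l0|x y IHx IHy].
- by rewrite !lmulpure0.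
- by rewrite !lmulpure_pure -mulrA center_comm mulrA tpure_bal mulrA.
by rewrite !lmulpureD IHx IHy.
Qed.

Let tmulP y := (tmul_gDl y, tmul_gDr y, tmul_gbal y).

Lemma tmul_pure b l b' l' :
  tmul (tpure b l) (tpure b' l') = tpure (b * b') (l * l').
Proof. by rewrite /tmul tlift_pure ?lmulpure_pure // => *; rewrite tmulP. Qed.

Lemma tmulDl : left_distributive tmul +%R.
Proof. by move=> x y z; rewrite /tmul tliftD // => *; rewrite tmulP. Qed.

Lemma tmul0l y : tmul 0 y = 0.
Proof. by apply: (addrI (tmul 0 y)); rewrite -tmulDl !addr0. Qed.

Lemma tmulDr : right_distributive tmul +%R.
Proof.
move=> x y z; elim/tensor_ind_add: x => [|b l|x x' IHx IHx'].
- by rewrite !tmul0l addr0.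
- rewrite /tmul !tlift_pure ?lmulpureD // => *; by rewrite tmulP.
by rewrite !tmulDl IHx IHx' addrACA.
Qed.

Lemma tmul0r y : tmul y 0 = 0.
Proof. by apply: (addrI (tmul y 0)); rewrite -tmulDr !addr0. Qed.

Lemma tmulA : associative tmul.
Proof.
move=> x y z; elim/tensor_ind_add: x => [|b l|x x' IHx IHx'].
- by rewrite !tmul0l.
- elim/tensor_ind_add: y => [|b' l'|y y' IHy IHy'].
  + by rewrite !(tmul0l, tmul0r).
  + elim/tensor_ind_add: z => [|b2 l2|z z' IHz IHz'].
    * by rewrite !tmul0r.
    * by rewrite !tmul_pure !mulrA.
    by rewrite !tmulDr IHz IHz'.
  by rewrite !(tmulDl, tmulDr) IHy IHy'.
by rewrite !tmulDl IHx IHx'.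
Qed.

Lemma tmul1 : left_id (tpure 1 1) tmul.
Proof.
elim/tensor_ind_add => [|b l|x y IHx IHy]; first exact: tmul0r.
  by rewrite tmul_pure !mul1r.
by rewrite tmulDr IHx IHy.
Qed.

Lemma tmulr1 : right_id (tpure 1 1) tmul.
Proof.
elim/tensor_ind_add => [|b l|x y IHx IHy]; first exact: tmul0l.
  by rewrite tmul_pure !mulr1.
by rewrite tmulDl IHx IHy.
Qed.

HB.instance Definition _ := GRing.Zmodule_isPzRing.Build tensor
  tmulA tmul1 tmulr1 tmulDl tmulDr.

Lemma tpureM b l b' l' : tpure b l * tpure b' l' = tpure (b * b') (l * l').
Proof. exact: tmul_pure. Qed.

Definition tscale (a : L) (x : tensor) : tensor := tpure 1 a * x.

Lemma tscale_pure a b l : tscale a (tpure b l) = tpure b (a * l).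
Proof. by rewrite /tscale tpureM mul1r. Qed.

Lemma tscaleA a b x : tscale a (tscale b x) = tscale (a * b) x.
Proof. by rewrite /tscale mulrA tpureM mul1r. Qed.

Lemma tscale1 : left_id 1 tscale.
Proof. exact: mul1r. Qed.

Lemma tscaleDr : right_distributive tscale +%R.
Proof. by move=> a x y; rewrite /tscale mulrDr. Qed.

Lemma tscaleDl x : {morph tscale^~ x : a b / a + b}.
Proof. by move=> a b; rewrite /tscale tpureDr mulrDl. Qed.

HB.instance Definition _ := GRing.Zmodule_isLmodule.Build L tensor
  tscaleA tscale1 tscaleDr tscaleDl.

Lemma tensor_scaleAl (a : L) (x y : tensor) : a *: (x * y) = a *: x * y.
Proof. exact: mulrA. Qed.

Lemma tensor_scaleAr (a : L) (x y : tensor) : a *: (x * y) = x * (a *: y).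
Proof.
suff com : tpure 1 a * x = x * tpure 1 a.
  by rewrite -[LHS]/(tpure 1 a * (x * y)) mulrA com -mulrA.
elim/tensor_ind_add: x => [|b l|x x' IHx IHx']; first by rewrite mulr0 mul0r.
  by rewrite !tpureM mul1r mulr1 mulrC.
by rewrite mulrDl mulrDr IHx IHx'.
Qed.

End CentralTensor.

Local Notation "x %:F" := (@FracField.tofrac _ x).

Section FractionLift.

Variables (R : idomainType) (K : fieldType) (phi : {rmorphism R -> K}).
Hypothesis phi_inj : injective phi.

Fact fraction_numden (q : {fraction R}) :
  exists n d : R, d != 0 /\ q * d%:F = n%:F.
Proof.
elim/quotW: q => x; exists \n_x, \d_x; split; first exact: denom_ratioP.
unlock FracField.tofrac.
have mulE (a b : {fraction R}) : a * b = FracField.mul a b by [].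
rewrite mulE -FracField.pi_mul; apply/eqmodP => /=.
rewrite FracField.equivfE /FracField.mulf !numden_Ratio ?oner_eq0 //.
  by rewrite !mulr1 mulrC.
all: by rewrite mulr1 denom_ratioP.
Qed.

Fact frac_lift_exists (q : {fraction R}) :
  {a : K | forall n d : R, d != 0 ->
     q * d%:F = n%:F -> a * phi d = phi n}.
Proof.
apply: cid; have [n0 [d0 [d0_neq0 q0]]] := fraction_numden q.
have nz d : d != 0 -> phi d != 0.
  by rewrite -(rmorph0 phi) (inj_eq phi_inj).
exists (phi n0 / phi d0) => n1 d1 _ q1.
have /eqP : (n0 * d1)%:F = (n1 * d0)%:F.
  by rewrite !rmorphM /= -q0 -q1 mulrAC.
rewrite tofrac_eq => /eqP /(congr1 phi); rewrite !rmorphM => E.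
by apply: (mulIf (nz _ d0_neq0)); rewrite -E mulrAC divfK ?nz // mulrC.
Qed.

Definition frac_lift (q : {fraction R}) : K := sval (frac_lift_exists q).

Lemma frac_liftP (q : {fraction R}) (n d : R) : d != 0 ->
  q * d%:F = n%:F -> frac_lift q * phi d = phi n.
Proof. exact: (svalP (frac_lift_exists q)). Qed.

Lemma frac_liftE (r : R) : frac_lift r%:F = phi r.
Proof.
by have := @frac_liftP r%:F r 1 (oner_neq0 _); rewrite !rmorph1 !mulr1; apply.
Qed.

Fact frac_lift_uniq (q : {fraction R}) (n d : R) (a : K) :
  d != 0 -> q * d%:F = n%:F -> a * phi d = phi n ->
  frac_lift q = a.
Proof.
move=> d0 qd ad; have nz : phi d != 0.
  by rewrite -(rmorph0 phi) (inj_eq phi_inj).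
by apply: (mulIf nz); rewrite ad (frac_liftP d0 qd).
Qed.

Lemma frac_lift_is_zmod_morphism : zmod_morphism frac_lift.
Proof.
move=> p q; have [n [d [d0 E]]] := fraction_numden p.
have [n' [d' [d0' E']]] := fraction_numden q.
apply: (frac_lift_uniq (n := n * d' - n' * d) (mulf_neq0 d0 d0')).
  by rewrite rmorphB !rmorphM /= -E -E' mulrBl mulrA; congr (_ - _); rewrite mulrCA mulrC.
rewrite rmorphB !rmorphM -(frac_liftP d0 E) -(frac_liftP d0' E').
by rewrite mulrBl mulrA; congr (_ - _); rewrite mulrCA mulrC.
Qed.

Lemma frac_lift_is_monoid_morphism : monoid_morphism frac_lift.
Proof.
split; first by rewrite -(rmorph1 (@FracField.tofrac R)) frac_liftE rmorph1.
move=> p q; have [n [d [d0 E]]] := fraction_numden p.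
have [n' [d' [d0' E']]] := fraction_numden q.
apply: (frac_lift_uniq (n := n * n') (mulf_neq0 d0 d0')).
  by rewrite !rmorphM /= -E -E' mulrACA.
by rewrite !rmorphM -(frac_liftP d0 E) -(frac_liftP d0' E') mulrACA.
Qed.

End FractionLift.

(* Matrices have size n.+1, so that the degree ranges over the positive
   integers, and there are m.+2 generic matrices, so that their number ranges
   over the integers greater than 1. *)
Section UniversalDivisionAlgebra.

Variables (k : fieldType) (n m : nat).

Definition gvar : finType := ('I_m.+2 * 'I_n.+1 * 'I_n.+1)%type.

Definition kX : idomainType := {mpoly k[#|gvar|]}.
Definition kXf : fieldType := {fraction kX}.

Definition kX_var (x : gvar) : kX := 'X_(enum_rank x) : {mpoly k[#|gvar|]}.
Definition kX_const (a : k) : kX := a%:MP_[#|gvar|].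

Definition generic_mx (s : 'I_m.+2) : 'M[kXf]_n.+1 :=
  \matrix_(i, j) (kX_var (s, i, j))%:F.

(* The k-subalgebra of M_(n.+1)(k(X)) generated by the generic matrices. *)
Inductive generated : 'M[kXf]_n.+1 -> Prop :=
| Gen_generic s : generated (generic_mx s)
| Gen_const a : generated (((kX_const a)%:F)%:M)
| Gen_add A B : generated A -> generated B -> generated (A + B)
| Gen_mul A B : generated A -> generated B -> generated (A * B).

Definition generic_pred : {pred 'M[kXf]_n.+1} := fun A => `[< generated A >].

Lemma genericP A : reflect (generated A) (A \in generic_pred).
Proof. exact: asboolP. Qed.

Lemma generic_subring : GRing.subring_closed generic_pred.
Proof.
have c1 : ((kX_const 1)%:F)%:M = 1 :> 'M[kXf]_n.+1 by rewrite /kX_const !rmorph1.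
have cN : ((kX_const (- 1))%:F)%:M = - 1 :> 'M[kXf]_n.+1.
  by rewrite /kX_const !(rmorphN, rmorph1).
split; first by apply/genericP; rewrite -c1; apply: Gen_const.
  move=> A B /genericP gA /genericP gB; apply/genericP/Gen_add => //.
  have -> : - B = ((kX_const (- 1))%:F)%:M * B.
    by rewrite cN mulN1r.
  by apply: Gen_mul => //; apply: Gen_const.
by move=> A B /genericP gA /genericP gB; apply/genericP/Gen_mul.
Qed.

HB.instance Definition _ := GRing.isSubringClosed.Build 'M[kXf]_n.+1
  generic_pred generic_subring.

Record generic_alg :=
  GenericAlg { generic_val :> 'M[kXf]_n.+1; _ : generic_val \in generic_pred }.

HB.instance Definition _ := [isSub for generic_val].
HB.instance Definition _ := [Choice of generic_alg by <:].
HB.instance Definition _ := [SubChoice_isSubNzRing of generic_alg by <:].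

Lemma generic_valP (b : generic_alg) : generated (generic_val b).
Proof. by case: b => A /= /genericP. Qed.

(* The words X ^+ (n - i) * Y * X ^+ j in the first two generic matrices are
   linearly independent over k(X): specializing X to the shift matrix and Y to
   a matrix unit turns them into the matrix units. *)
Section Scalar.

Let s0 : 'I_m.+2 := ord0.
Let s1 : 'I_m.+2 := lift ord0 ord0.

Let word (R : nzRingType) (X Y : 'M[R]_n.+1) (i j : 'I_n.+1) : 'M[R]_n.+1 :=
  X ^+ (n - i) * Y * X ^+ j.

Let idx (a : 'I_(n.+1 * n.+1)) : 'I_n.+1 * 'I_n.+1 :=
  enum_val (cast_ord (esym (mxvec_cast n.+1 n.+1)) a).

Let idxE a : mxvec_index (idx a).1 (idx a).2 = a.
Proof.
by rewrite /mxvec_index -surjective_pairing /idx enum_valK cast_ordKV.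
Qed.

Let words (R : nzRingType) (X Y : 'M[R]_n.+1) : 'M[R]_(n.+1 * n.+1) :=
  \matrix_a mxvec (word X Y (idx a).1 (idx a).2).

Let words_map (R S : nzRingType) (f : {rmorphism R -> S}) X Y :
  map_mx f (words X Y) = words (map_mx f X) (map_mx f Y).
Proof.
apply/row_matrixP => a; rewrite -map_row !rowK map_mxvec; congr mxvec.
by rewrite /word !rmorphM !rmorphXn.
Qed.

Let poly_mx (s : 'I_m.+2) : 'M[kX]_n.+1 := \matrix_(i, j) kX_var (s, i, j).

Let shift : 'M[k]_n.+1 := \matrix_(i, j) (i.+1 == j)%:R.
Let corner : 'M[k]_n.+1 := delta_mx ord_max ord0.

Let shiftX e i j : (shift ^+ e) i j = (i + e == j)%N%:R :> k.
Proof.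
elim: e j => [|e IH] j; first by rewrite expr0 mxE addn0.
rewrite exprSr mxE; under eq_bigr => l _ do rewrite IH mxE.
case: (ltnP (i + e)%N n.+1) => [lt|ge].
  rewrite (bigD1 (Ordinal lt)) //= eqxx mul1r big1 ?addr0 ?addnS //.
  move=> l; rewrite -val_eqE /= eq_sym => /negbTE->.
  by rewrite mul0r.
rewrite big1 => [|l _].
  by case: eqP => // E; move: (ltn_ord j); rewrite -E addnS ltnNge (leqW ge).
by case: eqP => [E|_]; rewrite ?mul0r //; 
  move: (ltn_ord l); rewrite -E ltnNge ge.
Qed.

Let word_unit i j : word shift corner i j = delta_mx i j.
Proof.
apply/matrixP => a b; rewrite /word !mxE (bigD1 ord0) //= big1 => [|l l0].
  rewrite addr0 mxE (bigD1 ord_max) //= big1 => [|l lm].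
    rewrite addr0 !shiftX mxE !eqxx mulr1 add0n -natrM mulnb.
    rewrite -[a == i]val_eqE -[b == j]val_eqE /= [(b : nat) == j]eq_sym.
    congr (_ && _)%:R; have := ltn_ord i; rewrite ltnS => lei.
    by rewrite -(eqn_add2r (n - i)%N a i) subnKC.
  by rewrite mxE (negbTE lm) mulr0.
rewrite [X in X * _]mxE big1 ?mul0r // => l' _.
by rewrite mxE (negbTE l0) andbF mulr0.
Qed.

Let words_unit : words shift corner = 1%:M.
Proof.
apply/row_matrixP => a.
by rewrite rowK word_unit mxvec_delta idxE row1.
Qed.

Let point (x : 'I_#|gvar|) : k :=
  let: (s, i, j) := (enum_val x : gvar) in
  if s == s0 then shift i j else corner i j.

Let point_mx0 : map_mx (meval point) (poly_mx s0) = shift.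
Proof. by apply/matrixP => i j; rewrite !mxE mevalXU /point enum_rankK eqxx mxE. Qed.

Let point_mx1 : map_mx (meval point) (poly_mx s1) = corner.
Proof. by apply/matrixP => i j; rewrite !mxE mevalXU /point enum_rankK /= mxE. Qed.

Let words_unitmx : words (generic_mx s0) (generic_mx s1) \in unitmx.
Proof.
have E s : generic_mx s = map_mx (@FracField.tofrac kX) (poly_mx s).
  by apply/matrixP => i j; rewrite !mxE.
rewrite !E -words_map unitmxE det_map_mx unitfE tofrac_eq0.
apply/eqP => /(congr1 (meval point)); rewrite meval0.
rewrite -(det_map_mx (meval point)) words_map point_mx0 point_mx1 words_unit.
by rewrite det1 => /eqP; rewrite oner_eq0.
Qed.

Lemma generic_span (A : 'M[kXf]_n.+1) :
  exists c : 'I_n.+1 -> 'I_n.+1 -> kXf,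
  A = \sum_i \sum_j c i j *:
        (generic_mx ord0 ^+ (n - i) * generic_mx (lift ord0 ord0)
         * generic_mx ord0 ^+ j).
Proof.
pose W := words (generic_mx s0) (generic_mx s1).
pose u := mxvec A *m invmx W.
exists (fun i j => u 0 (mxvec_index i j)).
have /(congr1 vec_mx) : mxvec A = u *m W by rewrite mulmxKV.
rewrite mxvecK mulmx_sum_row linear_sum /= => ->.
rewrite pair_big /= (reindex (fun p => mxvec_index p.1 p.2)) /=.
  apply: eq_bigr => -[i j] _; rewrite /= linearZ /= rowK mxvecK.
  by rewrite /idx /mxvec_index cast_ordK enum_rankK.
exists idx => [[i j] _|a _]; last exact: idxE.
by rewrite /idx /mxvec_index cast_ordK enum_rankK.
Qed.

End Scalar.

Lemma generic_central_scalar (r : ring_center generic_alg) :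
  generic_val (center_val r) = (generic_val (center_val r) 0 0)%:M.
Proof.
set c := generic_val (center_val r).
have gc A : generated A -> c * A = A * c.
  move=> /genericP gA; have := center_comm r (GenericAlg gA).
  by move=> /(congr1 val).
have cA A : c * A = A * c.
  have [u ->] := generic_span A.
  rewrite mulr_sumr mulr_suml; apply: eq_bigr => i _.
  rewrite mulr_sumr mulr_suml; apply: eq_bigr => j _.
  rewrite -scalerAr -scalerAl gc //.
  have gX e : generated (generic_mx ord0 ^+ e).
    elim: e => [|e IH]; last by rewrite exprS; apply: Gen_mul (Gen_generic _) IH.
    by apply/genericP; rewrite expr0 rpred1.
  by apply: Gen_mul => //; apply: Gen_mul => //; apply: Gen_generic.
apply/matrixP => i j; move: (cA (delta_mx j 0)) => /matrixP/(_ i 0).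
rewrite !mxE (bigD1 j) //= big1 => [|l lj].
  rewrite addr0 mxE !eqxx mulr1 => ->.
  rewrite (bigD1 0) //= big1 => [|l l0].
    by rewrite addr0 mxE andbT mulr_natl.
  by rewrite mxE (negbTE l0) andbF mul0r.
by rewrite mxE (negbTE lj) mulr0.
Qed.

Definition generic_center_type : Type := ring_center generic_alg.

HB.instance Definition _ := GRing.ComNzRing.on generic_center_type.

Definition center_scalar (r : generic_center_type) : kXf :=
  generic_val (center_val r) 0 0.

Lemma center_scalarE (r : generic_center_type) :
  generic_val (center_val r) = (center_scalar r)%:M.
Proof. exact: generic_central_scalar. Qed.

Lemma center_scalar_inj : injective center_scalar.
Proof.
by move=> r s rs; do 2!apply: val_inj; rewrite /= !center_scalarE rs.
Qed.

Lemma center_scalar_is_zmod_morphism : zmod_morphism center_scalar.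
Proof. by move=> r s; rewrite /center_scalar /= !mxE. Qed.

Lemma center_scalar_is_monoid_morphism : monoid_morphism center_scalar.
Proof.
split; first by rewrite /center_scalar /= mxE eqxx.
move=> r s; rewrite {1}/center_scalar /= !center_scalarE.
by rewrite -[_ * _]scalar_mxM mxE eqxx.
Qed.

HB.instance Definition _ := GRing.isZmodMorphism.Build generic_center_type kXf
  center_scalar center_scalar_is_zmod_morphism.
HB.instance Definition _ := GRing.isMonoidMorphism.Build generic_center_type kXf
  center_scalar center_scalar_is_monoid_morphism.

Lemma generic_center_integral (r s : generic_center_type) :
  r * s = 0 -> (r == 0) || (s == 0).
Proof.
move=> /(congr1 center_scalar); rewrite rmorphM rmorph0 => /eqP.
by rewrite mulf_eq0 -!(rmorph0 center_scalar) !(inj_eq center_scalar_inj).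
Qed.

Definition generic_center_unit : {pred generic_center_type} :=
  fun r => `[< exists s, s * r = 1 >].

Definition generic_center_inv (r : generic_center_type) : generic_center_type :=
  if pselect (exists s, s * r = 1) is left e then sval (cid e) else r.

Fact generic_center_mulVr :
  {in generic_center_unit, left_inverse 1 generic_center_inv *%R}.
Proof.
move=> r /asboolP ur; rewrite /generic_center_inv.
by case: pselect => // e; case: cid.
Qed.

Fact generic_center_unitP (r s : generic_center_type) :
  s * r = 1 -> r \in generic_center_unit.
Proof. by move=> sr; apply/asboolP; exists s. Qed.

Fact generic_center_inv_out :
  {in [predC generic_center_unit], generic_center_inv =1 id}.
Proof.
move=> r; rewrite inE => /asboolPn nur; rewrite /generic_center_inv.
by case: pselect.
Qed.

HB.instance Definition _ := GRing.ComNzRing_hasMulInverse.Build generic_center_type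
  generic_center_mulVr generic_center_unitP generic_center_inv_out.
HB.instance Definition _ := GRing.ComUnitRing_isIntegral.Build generic_center_type
  generic_center_integral.

Definition generic_center : idomainType := generic_center_type.

Definition generic_field : fieldType := {fraction generic_center}.

Definition generic_center_frac : {rmorphism generic_center -> generic_field} :=
  @FracField.tofrac generic_center.

(* The generic matrix algebra tensored, over its center, with the field of
   fractions of its center. *)
Definition UD : Type := @tensor generic_alg generic_field generic_center_frac.

HB.instance Definition _ := GRing.PzRing.on UD.
HB.instance Definition _ := GRing.Lmodule.on UD.

Definition field_scalar : generic_field -> kXf :=
  @frac_lift generic_center kXf center_scalar center_scalar_inj.

HB.instance Definition _ := GRing.isZmodMorphism.Build generic_field kXf
  field_scalar (frac_lift_is_zmod_morphism center_scalar_inj).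
HB.instance Definition _ := GRing.isMonoidMorphism.Build generic_field kXf
  field_scalar (frac_lift_is_monoid_morphism center_scalar_inj).

Lemma field_scalarE (r : generic_center) : field_scalar r%:F = center_scalar r.
Proof. exact: (frac_liftE center_scalar_inj). Qed.

Definition UD_mx : UD -> 'M[kXf]_n.+1 :=
  tlift (fun (b : generic_alg) (l : generic_field) =>
           field_scalar l *: generic_val b).

Lemma UD_mx_pure (b : generic_alg) (l : generic_field) :
  UD_mx (tpure generic_center_frac b l) = field_scalar l *: generic_val b.
Proof.
rewrite /UD_mx tlift_pure //.
- by move=> *; rewrite -scalerDr.
- by move=> *; rewrite rmorphD scalerDl.
move=> b' r l'; rewrite rmorphM /=.
have -> : field_scalar (generic_center_frac r) = center_scalar r.
  exact: field_scalarE.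
rewrite /= center_scalarE -[_ * _%:M]/(_ *m _) mul_mx_scalar scalerA.
by rewrite mulrC.
Qed.

Fact UD_oner_neq0 : (1 : UD) != 0.
Proof.
apply/eqP => E.
have U1 : UD_mx 1 = 1.
  rewrite -[1 in LHS]/(tpure generic_center_frac 1 1) UD_mx_pure.
  by rewrite rmorph1 scale1r.
have U0 : UD_mx 0 = 0.
  by rewrite -(tpure0l generic_center_frac 0) UD_mx_pure scaler0.
by move: (oner_neq0 'M[kXf]_n.+1); rewrite -U1 E U0 eqxx.
Qed.

HB.instance Definition _ := GRing.PzSemiRing_isNonZero.Build UD UD_oner_neq0.
HB.instance Definition _ := GRing.Lmodule_isLalgebra.Build generic_field UD
  (@tensor_scaleAl _ _ generic_center_frac).
HB.instance Definition _ := GRing.Lalgebra_isAlgebra.Build generic_field UD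
  (@tensor_scaleAr _ _ generic_center_frac).

End UniversalDivisionAlgebra.

(* Main.v *)
From HB Require Import structures.
From mathcomp Require Import all_boot all_order all_algebra all_fingroup all_solvable all_field.
From mathcomp Require Import boolp classical_sets cardinality.
From mathcomp Require Import finmap mpoly mxtens.
Require Import Defs.

Set Implicit Arguments.
Unset Strict Implicit.
Unset Printing Implicit Defensive.

Import Order.TTheory GRing.Theory.
Local Open Scope ring_scope.

(** Suppose that D = UD(k, n) has a maximal subfield K that is Galois over the center, with
    Galois group G.  Then G has order n, and each s in G is conjugation by some u in D, that
    is, u x = s(x) u for x in K ([exists_intertwiner], [galois_degree]).  If s has order d and
    y = s(x) - x, then the sum of s^i(y) over i < d telescopes to zero; in D this is the
    homogeneous identity

      sum_(i < d) u^i y u^(d-1-i) = 0    ([intertwines_conj_sum]).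

    Being homogeneous, it can be multiplied into the generic matrix algebra B
    ([UD_integral_multiple]) and then specialized to other algebras of degree n.

    The algebras used are quantum tori: the matrices over k'[t_1, .., t_r] spanned by terms
    t^a E_a, where k' is an extension of k with a primitive n-th root of unity, and E_a is the
    monomial with exponent a in fixed invertible matrices that commute up to N-th roots of
    unity and generate all matrices ([torus_data], [torus_alg]).  The leading coefficient of a
    nonzero element is a multiple of some E_a, so it is invertible.  Since k is infinite,
    nonzero elements of B have nonzero images under suitable specializations
    ([generated_specialize]).  If the leading coefficients of u and y commute, then the left
    side of the identity has the leading coefficient d e^(d-1) f, with e and f the leading
    coefficients of u and y; it is not zero because d divides n, which is prime to the
    characteristic ([leads_conj_sum]).  So no torus in which e and f have to commute admits a
    nontrivial s.  Two tori now lead to incompatible conclusions on a Sylow p-subgroup P of G.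
    Write n = p^r q with q prime to p.

    - The tensor product of r clock and shift pairs of size p and one of size q has N = p q
      ([torus_data_elementary]).  Hence every element of G has order dividing p q
      ([UD_galois_exponent]), and those of P have order dividing p.
    - A single clock and shift pair of size n has two variables only.  An element of P is
      determined by a character with values in p-th roots of unity on a lattice of rank two,
      so that P has at most p^2 elements ([UD_galois_rank]).

    As P has p^r elements and r is at least 3, this is a contradiction.

    The statements on D and K require that D is a division algebra, that is, that B has enough
    central elements ([generic_division]).  These come from Capelli sums, which are alternating
    in n^2 elements of B and hence equal to a determinant times a fixed matrix
    ([capelli_det]): multiplication by the coefficients of the characteristic polynomial of an
    element of B maps a suitable nonzero W back into B ([regular_char_poly_coef]), and the
    theorem of Cayley and Hamilton for W^2 then turns such coefficients into scalar matrices
    in B. *)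

(** * Roots of unity, and points where a polynomial does not vanish *)

(** A nonconstant divisor of p of least size is irreducible, so that a root of it can be
    adjoined to F. *)
Lemma exists_root_extension (F : fieldType) (p : {poly F}) :
  (1 < size p)%N ->
  exists (L : fieldType) (f : {rmorphism F -> L}) (x : L), root (map_poly f p) x.
Proof.
move=> sz.
pose P m := `[< exists q : {poly F}, [/\ q %| p, (1 < size q)%N & size q = m] >].
have exP : exists m, P m by exists (size p); apply/asboolP; exists p; rewrite dvdpp.
case: (ex_minnP exP) => m0 /asboolP[{}q [{}qp {}q1 qs]] qmin.
have irr : irreducible_poly q.
  split=> // r r1 rq; rewrite -dvdp_size_eqp // eqn_leq dvdp_leq //=; last first.
    by rewrite -size_poly_gt0 (ltn_trans _ q1).
  rewrite qs; apply: qmin; apply/asboolP; exists r; split=> //.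
    exact: dvdp_trans rq qp.
  rewrite ltn_neqAle eq_sym r1 /= size_poly_gt0.
  apply: contraTneq rq => ->; rewrite dvd0p -size_poly_gt0; by case: size q1 => [].
have [L _ [z rz _]] := irredp_FAdjoin irr.
exists L, (in_alg L : {rmorphism F -> L}), z.
by rewrite -dvdp_XsubCl (dvdp_trans _ (_ : map_poly (in_alg L) q %| _)) ?dvdp_XsubCl ?dvdp_map.
Qed.

Lemma exists_splitting_extension (F : fieldType) (p : {poly F}) : p != 0 ->
  exists (L : fieldType) (f : {rmorphism F -> L}) (rs : seq L),
    map_poly f p = f (lead_coef p) *: \prod_(x <- rs) ('X - x%:P).
Proof.
move: {2}(size p) (leqnn (size p)) => m.
elim: m F p => [|m IH] F p; first by rewrite leqn0 size_poly_eq0 => /eqP->; rewrite eqxx.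
move=> szp p0; case: (ltnP 1 (size p)) => [p1|/size1_polyC pC]; last first.
  exists F, (idfun : {rmorphism F -> F}), [::].
  by rewrite big_nil {1}pC map_polyC /= pC lead_coefC coefC eqxx alg_polyC.
have [L [f [x]]] := exists_root_extension p1.
move=> /factor_theorem [q Eq].
have q0 : q != 0.
  apply: contraNneq p0 => q0; move: Eq; rewrite q0 mul0r => /eqP.
  by rewrite map_poly_eq0.
have szq : (size q <= m)%N.
  have := congr1 (fun r : {poly L} => size r) Eq.
  rewrite size_map_poly size_Mmonic ?monicXsubC // size_XsubC addn2 /= => E.
  by move: szp; rewrite E.
have [L' [f' [rs E']]] := IH L q szq q0.
exists L', (f' \o f : {rmorphism F -> L'}), (f' x :: rs).
rewrite map_poly_comp Eq rmorphM /= E' rmorphB /= map_polyX map_polyC /=.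
rewrite big_cons mulrC -scalerAr; congr (_ *: _).
rewrite -(lead_coef_map f p) Eq lead_coefM lead_coefXsubC mulr1 //.
Qed.

(** As n is invertible in F, the polynomial 'X^n - 1 is separable.  An extension over which
    it splits contains n roots of unity, and they form a cyclic group. *)
Lemma exists_primitive_root_extension (F : fieldType) (n : nat) :
  (0 < n)%N -> n%:R != 0 :> F ->
  exists (L : fieldType) (f : {rmorphism F -> L}) (z : L), n.-primitive_root z.
Proof.
move=> n0 nF.
have p0 : 'X^n - 1 != 0 :> {poly F} by rewrite -size_poly_eq0 size_XnsubC.
have [L [f [rs]]] := exists_splitting_extension p0.
rewrite (eqP (monicXnsubC _ n0)) rmorph1 scale1r => E.
have {}E : 'X^n - 1 = \prod_(x <- rs) ('X - x%:P) by rewrite -E rmorphB rmorph1 /= map_polyXn.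
have sep : uniq rs.
  rewrite -separable_prod_XsubC -E cyclotomic.separable_Xn_sub_1 //.
  by rewrite -(rmorph_nat f) fmorph_eq0.
have szrs : size rs = n.
  have := congr1 (fun r : {poly L} => size r) E.
  by rewrite size_XnsubC // size_prod_XsubC => -[].
have /hasP[z _ pz] : has n.-primitive_root rs.
  apply: has_prim_root; rewrite ?szrs //.
  by apply/allP => x xrs; rewrite /root_of_unity E root_prod_XsubC.
by exists L, f, z.
Qed.

Lemma infinite_nonroot (k : fieldType) (q : {poly k}) :
  infinite_set [set: k]%classic -> q != 0 -> exists x, ~~ root q x.
Proof.
move=> /(@infinite_set_fset _ _ (size q)) [B _ sB] q0.
apply: contrapT => nex.
have := max_poly_roots q0 (_ : all (root q) (enum_fset B)) (fset_uniq B).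
rewrite ltnNge sB => /(_ _)/negP; apply=> //.
by apply/allP => x _; apply: contrapT => /negP rx; apply: nex; exists x.
Qed.

(** Induction on N: the leading coefficient of p with respect to the last variable has a
    point where it does not vanish, and there p becomes a nonzero univariate polynomial. *)
Lemma mpoly_nonvanishing (k : fieldType) (N : nat) (p : {mpoly k[N]}) :
  infinite_set [set: k]%classic -> p != 0 -> exists v : 'I_N -> k, p.@[v] != 0.
Proof.
move=> kinf; elim: N p => [|N IH] p p0.
  exists (fun=> 0); rewrite (nvar0_mpolyC p) mevalC.
  by move: p0; rewrite {1}(nvar0_mpolyC p) mpolyC_eq0.
have [x0 px]: exists m, p@_m != 0.
  by exists (mlead p); rewrite mleadc_eq0.
pose w (m : 'X_{1..N.+1}) := [multinom (m (widen_ord (leqnSn N) i)) | i < N].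
have cE : ((muni p)`_(x0 ord_max))@_(w x0) = p@_x0.
  rewrite muniE coef_sum raddf_sum /= [p in RHS](mpolyE p) raddf_sum /=.
  apply: eq_bigr => m _; rewrite coefZ coefXn mcoeffZ mcoeffX.
  have [->|] := eqVneq m x0.
    by rewrite eqxx mulr1 mcoeffZ mcoeffX eqxx.
  move=> mx; case: eqP => E; last by rewrite mulr0 mcoeff0 mulr0.
  rewrite mulr1 mcoeffZ mcoeffX; case: eqP => // E'; case/eqP: mx.
  apply/mnmP => i; case: (unliftP ord_max i) => [j ->|->]; last by rewrite E.
  have := congr1 (fun u : 'X_{1..N} => u j) E'; rewrite !mnmE.
  by rewrite (_ : lift ord_max j = widen_ord (leqnSn N) j) //;
    apply: val_inj; rewrite /= /bump leqNgt ltn_ord.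
have q0 : lead_coef (muni p) != 0.
  rewrite lead_coef_eq0; apply: contraNneq px => E.
  by rewrite -cE E coef0 mcoeff0.
have [v v0] := IH _ q0.
pose q := map_poly (meval v) (muni p).
have q1 : q != 0.
  apply: contraNneq v0 => /(congr1 (fun r : {poly k} => r`_(size (muni p)).-1)).
  by rewrite coef_map coef0 /= => ->.
have [x qx] := infinite_nonroot kinf q1.
pose vx (i : 'I_N.+1) := if unlift ord_max i is Some j then v j else x.
exists vx; suff -> : p.@[vx] = q.[x] by [].
rewrite /q muniE rmorph_sum horner_sum mevalE; apply: eq_bigr => m _.
rewrite /= map_polyZ /= map_polyXn hornerZ hornerXn mevalZ mevalX.
rewrite big_ord_recr /= -mulrA; congr (_ * (_ * _)); last by rewrite /vx unlift_none.
apply: eq_bigr => i _; rewrite mnmE /vx.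
rewrite (_ : widen_ord _ i = lift ord_max i) ?liftK //.
by apply: val_inj; rewrite /= /bump leqNgt ltn_ord.
Qed.

(** * Generators of quantum tori *)

Section TorusData.

Variables (K : fieldType) (a : nat).

Definition commute_upto (N : nat) (A B : 'M[K]_a) : Prop :=
  exists2 c : K, c ^+ N = 1 & A *m B = c *: (B *m A).

Definition mx_alg_closed (S : 'M[K]_a -> Prop) : Prop :=
  [/\ forall c, S c%:M, forall A B, S A -> S B -> S (A + B) &
      forall A B, S A -> S B -> S (A *m B)].

Definition mx_alg_generate (t : nat) (g : 'I_t -> 'M[K]_a) : Prop :=
  forall S, mx_alg_closed S -> (forall i, S (g i)) -> forall A, S A.

(** If each g i is multiplied by a new central variable, the products span a quantum torus
    inside the matrices of size a; the orders of its commutation factors divide N. *)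
Definition torus_data (N t : nat) (g : 'I_t -> 'M[K]_a) : Prop :=
  [/\ forall i, g i \in unitmx, forall i j, commute_upto N (g i) (g j) &
      mx_alg_generate g].

End TorusData.

Section Tensor.

Variables (K : fieldType) (a b N s t : nat).
Variables (g : 'I_s -> 'M[K]_a) (h : 'I_t -> 'M[K]_b).

Definition tensor_family (i : 'I_(s + t)) : 'M[K]_(a * b) :=
  match split i with inl j => g j *t 1%:M | inr j => 1%:M *t h j end.

Lemma tensmxZl (c : K) (A : 'M[K]_a) (B : 'M[K]_b) : (c *: A) *t B = c *: (A *t B).
Proof.
apply/matrixP => i j; case: (mxtens_indexP i) => i0 i1; case: (mxtens_indexP j) => j0 j1.
by rewrite !mxE !mxtens_indexK mulrA.
Qed.

Lemma tensmxZr (c : K) (A : 'M[K]_a) (B : 'M[K]_b) : A *t (c *: B) = c *: (A *t B).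
Proof.
apply/matrixP => i j; case: (mxtens_indexP i) => i0 i1; case: (mxtens_indexP j) => j0 j1.
by rewrite !mxE !mxtens_indexK mulrCA.
Qed.

Lemma tensmxDl (A A' : 'M[K]_a) (B : 'M[K]_b) : (A + A') *t B = A *t B + A' *t B.
Proof.
apply/matrixP => i j; case: (mxtens_indexP i) => i0 i1; case: (mxtens_indexP j) => j0 j1.
by rewrite !mxE !mxtens_indexK mulrDl.
Qed.

Lemma tensmxDr (A : 'M[K]_a) (B B' : 'M[K]_b) : A *t (B + B') = A *t B + A *t B'.
Proof.
apply/matrixP => i j; case: (mxtens_indexP i) => i0 i1; case: (mxtens_indexP j) => j0 j1.
by rewrite !mxE !mxtens_indexK mulrDr.
Qed.

Lemma tensmx11 : (1%:M : 'M[K]_a) *t (1%:M : 'M[K]_b) = 1%:M.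
Proof.
apply/matrixP => i j; case: (mxtens_indexP i) => i0 i1; case: (mxtens_indexP j) => j0 j1.
rewrite !mxE !mxtens_indexK /= (can_eq (@mxtens_indexK _ _)) xpair_eqE.
by rewrite -natrM mulnb.
Qed.

(** Generators of different factors commute, and the matrices A *t B span everything. *)
Lemma torus_data_tensor : torus_data N g -> torus_data N h -> torus_data N tensor_family.
Proof.
move=> [ug cg gg] [uh ch gh]; split.
- move=> i; rewrite /tensor_family; case: split => j.
    apply: (proj1 (mulmx1_unit (_ : _ *m (invmx (g j) *t 1%:M) = 1%:M))).
    by rewrite tensmx_mul mulmxV // mul1mx tensmx11.
  apply: (proj1 (mulmx1_unit (_ : _ *m (1%:M *t invmx (h j)) = 1%:M))).
  by rewrite tensmx_mul mulmxV // mul1mx tensmx11.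
- move=> i j; rewrite /tensor_family; case: split => k; case: split => l.
  + by have [c cN E] := cg k l; exists c; rewrite // !tensmx_mul E tensmxZl.
  + by exists 1; rewrite ?expr1n // !tensmx_mul !mulmx1 !mul1mx scale1r.
  + by exists 1; rewrite ?expr1n // !tensmx_mul !mulmx1 !mul1mx scale1r.
  + by have [c cN E] := ch k l; exists c; rewrite // !tensmx_mul E tensmxZr.
move=> S [Sc SD SM] Sf.
have Sg A : S (A *t 1%:M).
  move: A; apply: (gg (fun A => S (A *t 1%:M))).
    split=> [c|A B|A B]; first by rewrite -(scalemx1 _ c) tensmxZl tensmx11 scalemx1.
      by rewrite tensmxDl; apply: SD.
    move=> SA SB; have := SM _ _ SA SB.
    by rewrite tensmx_mul mulmx1.
  by move=> i; have := Sf (lshift _ i); rewrite /tensor_family (unsplitK (inl _)).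
have Sh B : S (1%:M *t B).
  move: B; apply: (gh (fun B => S (1%:M *t B))).
    split=> [c|A B|A B]; first by rewrite -(scalemx1 _ c) tensmxZr tensmx11 scalemx1.
      by rewrite tensmxDr; apply: SD.
    move=> SA SB; have := SM _ _ SA SB.
    by rewrite tensmx_mul mulmx1.
  by move=> i; have := Sf (rshift _ i); rewrite /tensor_family (unsplitK (inr _)).
have S0 : S 0 by rewrite -(scale0r 1%:M) scalemx1.
move=> A; rewrite [A]matrix_sum_delta.
apply: (big_ind S) => // i _; apply: (big_ind S) => // j _.
rewrite -mul_scalar_mx; apply: (SM) => //.
case: (mxtens_indexP i) => i0 i1; case: (mxtens_indexP j) => j0 j1.
rewrite (_ : delta_mx _ _ = (delta_mx i0 j0 *t 1%:M) *m (1%:M *t delta_mx i1 j1));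
  first exact: (SM).
rewrite tensmx_mul mulmx1 mul1mx; apply/matrixP => x y.
case: (mxtens_indexP x) => x0 x1; case: (mxtens_indexP y) => y0 y1.
rewrite tensmxE !mxE -natrM mulnb !(can_eq (@mxtens_indexK _ _)) !xpair_eqE.
by rewrite andbACA.
Qed.

End Tensor.

Section ClockShift.

Variables (K : fieldType) (a : nat) (z : K).
Hypothesis z_prim : a.+1.-primitive_root z.

Definition clock_mx : 'M[K]_a.+1 := diag_mx (\row_i z ^+ i).
Definition shift_mx : 'M[K]_a.+1 := \matrix_(i, j) (j == ordS i)%:R.
Definition clock_shift (i : 'I_2) : 'M[K]_a.+1 := if i == ord0 then clock_mx else shift_mx.

Lemma shift_mx_perm : shift_mx = perm_mx (perm (@ordS_inj a.+1)).
Proof. by apply/matrixP => i j; rewrite !mxE permE eq_sym. Qed.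

Lemma clock_shift_comm : shift_mx *m clock_mx = z *: (clock_mx *m shift_mx).
Proof.
apply/matrixP => i j; rewrite mul_mx_diag mul_diag_mx !mxE.
case: eqP => [->|]; rewrite ?mul0r ?mulr0 // mulr1 mul1r -exprS /=.
by rewrite (prim_expr_mod z_prim).
Qed.

(** The clock matrix has distinct eigenvalues z ^+ i, so that the diagonal matrix units are
    polynomials in it, and products with the shift move these to all matrix units. *)
Lemma torus_data_clock_shift : torus_data a.+1 clock_shift.
Proof.
have z1 := prim_expr_order z_prim.
have z0 : z != 0 by apply: contraTneq (oner_neq0 K) => z0; rewrite -z1 z0 expr0n eqxx.
split.
- move=> i; rewrite /clock_shift; case: ifP => _; last by rewrite shift_mx_perm unitmx_perm.
  rewrite unitmxE det_diag unitfE prodf_seq_neq0; apply/allP => j _.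
  by rewrite mxE expf_neq0.
- move=> i j; rewrite /clock_shift; case: ifP => _; case: ifP => _.
  + by exists 1; rewrite ?expr1n ?scale1r.
  + exists z^-1; first by rewrite exprVn z1 invr1.
    by rewrite clock_shift_comm scalerA mulVf ?scale1r.
  + by exists z; rewrite ?clock_shift_comm.
  + by exists 1; rewrite ?expr1n ?scale1r.
move=> S [Sc SD SM] Sg.
have Sclock : S clock_mx := Sg ord0.
have Sshift : S shift_mx := Sg (lift ord0 ord0).
have Sdiag i : S (delta_mx i i).
  (* Lagrange interpolation at the eigenvalues *)
  pose q : {poly K} := \prod_(j < a.+1 | j != i) ('X - (z ^+ j)%:P).
  have -> : delta_mx i i = (q.[z ^+ i]^-1)%:M *m horner_mx clock_mx q.
    have -> : horner_mx clock_mx q = diag_mx (\row_j q.[z ^+ j]).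
      rewrite /clock_mx horner_mx_diag; congr diag_mx.
      by apply/rowP => j; rewrite !mxE.
    rewrite mul_scalar_mx; apply/matrixP => x y; rewrite !mxE.
    have [->|xi] := eqVneq x i.
      rewrite [y == i]eq_sym; case: eqP => // _; last by rewrite mulr0.
      rewrite mulr1n mulVf // horner_prod; apply/prodf_neq0 => j ji.
      rewrite !hornerE subr_eq0 (eq_prim_root_expr z_prim).
      by rewrite !modn_small // eq_sym.
    have -> : q.[z ^+ x] = 0.
      by rewrite horner_prod (bigD1 x) //= !hornerE subrr mul0r.
    by rewrite mul0rn mulr0.
  apply: (SM) => //; rewrite /q rmorph_prod /=.
  apply: (big_ind S) => // [|j _]; first exact: Sc.
  rewrite rmorphB /= horner_mx_X horner_mx_C; apply: SD => //.
  by rewrite -scaleN1r -mul_scalar_mx; apply: (SM) => //; apply: Sc.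
have Siter i m : S (delta_mx i (iter m (@ordS _) i)).
  elim: m => [|m IH] //=.
  rewrite (_ : delta_mx _ _ = delta_mx i (iter m (@ordS _) i) *m shift_mx); first exact: (SM).
  apply/matrixP => x y; rewrite !mxE (bigD1 (iter m (@ordS _) i)) //= big1 => [|l li].
    by rewrite !mxE eqxx andbT addr0 -natrM mulnb.
  by rewrite mxE (negbTE li) andbF mul0r.
have Sdelta i j : S (delta_mx i j).
  (* a.+1 - i steps lead from i around the cycle to 0, and j more steps to j *)
  suff -> : j = iter (j + (a.+1 - i)) (@ordS _) i by [].
  have iterE m : iter m (@ordS a.+1) i = ((i + m) %% a.+1)%N :> nat.
    elim: m => [|m IH] /=; first by rewrite addn0 modn_small.
    by rewrite IH -addn1 modnDml addn1 addnS.
  apply: val_inj; rewrite /= iterE addnCA subnKC; last exact: ltnW.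
  by rewrite modnDr modn_small.
have S0 : S 0 by rewrite -(scale0r 1%:M) scalemx1.
move=> A; rewrite [A]matrix_sum_delta.
apply: (big_ind S) => // i _; apply: (big_ind S) => // j _.
by rewrite -mul_scalar_mx; apply: (SM).
Qed.

End ClockShift.

(** * Leading terms of matrices of polynomials *)

Section Leading.

Variables (K : fieldType) (t n : nat).
Implicit Types (M P : 'M[{mpoly K[t]}]_n.+1) (x y : 'X_{1..t}).

(** The coefficient e of the monomial x is allowed to vanish: this makes the relation stable
    under products and under sums with a common x. *)
Definition leads M x (e : 'M[K]_n.+1) : Prop :=
  (forall i j, (mlead (M i j) <= x)%O) /\ map_mx (mcoeff x) M = e.

Lemma leadsM M P x y e f : leads M x e -> leads P y f -> leads (M * P) (x + y)%MM (e * f).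
Proof.
move=> [Mx <-] [Py <-]; split.
  move=> i j; rewrite mxE; apply: (le_trans (mlead_sum_le _ _ _)).
  apply/joinsP => l _; apply: (le_trans (mleadM_le _ _)); exact: lem_add.
apply/matrixP => i j; rewrite !mxE raddf_sum /=; apply: eq_bigr => l _.
by rewrite !mxE mleadcMW.
Qed.

Lemma leads1 : leads 1 0%MM 1.
Proof.
split=> [i j|].
  rewrite mxE -mpolyC_nat mleadC //.
by apply/matrixP => i j; rewrite !mxE mcoeffMn mcoeff1 eqxx.
Qed.

Lemma leadsX M x e m : leads M x e -> leads (M ^+ m) (x *+ m)%MM (e ^+ m).
Proof.
move=> Me; elim: m => [|m IH]; first by rewrite mulm0n !expr0; apply: leads1.
by rewrite mulmS !exprS; apply: leadsM.
Qed.

Lemma leads_sum (I : Type) (r : seq I) (F : I -> 'M[{mpoly K[t]}]_n.+1) x e :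
  (forall i, leads (F i) x (e i)) -> leads (\sum_(i <- r) F i) x (\sum_(i <- r) e i).
Proof.
move=> Fe; split=> [i j|].
  rewrite summxE; apply: (le_trans (mlead_sum_le _ _ _)).
  by apply: joins_le => l _; case: (Fe l).
rewrite (raddf_sum (map_mx (mcoeff x))); apply: eq_bigr => l _.
by case: (Fe l).
Qed.

Lemma leads_exist M : M != 0 -> exists x e, e != 0 /\ leads M x e.
Proof.
move=> M0; have [[i0 j0] M00] : exists ij : 'I_n.+1 * 'I_n.+1, M ij.1 ij.2 != 0.
  apply: contrapT => nex; case/eqP: M0; apply/matrixP => i j; rewrite mxE.
  apply: contrapT => /eqP Mij.
  by apply: nex; exists (i, j).
case: (@Order.TotalTheory.arg_maxP _ _ _ (i0, j0) (fun p => M p.1 p.2 != 0)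
  (fun p => mlead (M p.1 p.2)) M00).
move=> [i j] /= Mij maxij; exists (mlead (M i j)), (map_mx (mcoeff (mlead (M i j))) M); split.
  apply: contraNneq Mij => /matrixP/(_ i j); rewrite !mxE => /eqP.
  by rewrite mleadc_eq0.
split=> // i' j'; have [->|nz] := eqVneq (M i' j') 0; first by rewrite mlead0 le0x.
exact: (maxij (i', j')).
Qed.

(** All d summands have the same leading coefficient e ^+ d.-1 * f, and it is invertible, so
    that only the integer factor d can make the sum vanish. *)
Lemma leads_conj_sum M P x y e f d :
  e \in unitmx -> f \in unitmx -> e * f = f * e ->
  leads M x e -> leads P y f -> \sum_(i < d) M ^+ i * P * M ^+ (d.-1 - i) = 0 ->
  d%:R = 0 :> K.
Proof.
case: d => [|d] // ue uf ef Me Pf sum0.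
have tm (i : 'I_d.+1) : leads (M ^+ i * P * M ^+ (d - i)) (x *+ d + y)%MM (e ^+ d * f).
  have := leadsM (leadsM (leadsX i Me) Pf) (leadsX (d - i) Me).
  have -> : (x *+ i + y + x *+ (d - i) = x *+ d + y)%MM.
    apply/mnmP => l; rewrite !(mnmDE, mulmnE) addnAC -mulnDr subnKC // -ltnS //.
  suff -> : e ^+ i * f * e ^+ (d - i) = e ^+ d * f by [].
  rewrite -mulrA (commrX (d - i) (_ : GRing.comm f e)) //.
  by rewrite mulrA -exprD subnKC // -ltnS.
have [_] := leads_sum (index_enum 'I_d.+1) tm.
rewrite sum0 map_mx0 sumr_const card_ord => /esym/eqP.
have uE : e ^+ d * f \in unitmx.
  by rewrite -[_ * _]/(_ *m _) unitmx_mul uf andbT; apply: (@unitrX 'M[K]_n.+1).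
move=> /eqP E; have := congr1 (fun A : 'M[K]_n.+1 => (A * (e ^+ d * f)^-1) 0 0) E.
by rewrite /= mulrnAl divrr // mul0r -scaler_nat !mxE eqxx mulr1.
Qed.

End Leading.

(** * The algebra of a quantum torus *)

Section Graded.

Variables (K : fieldType) (n N t : nat) (g : 'I_t -> 'M[K]_n.+1).
Hypothesis g_torus : torus_data N g.
Hypothesis N_gt0 : (0 < N)%N.

Lemma commute_upto_sym (A B : 'M[K]_n.+1) : commute_upto N A B -> commute_upto N B A.
Proof.
move=> [c cN E]; exists c^-1; first by rewrite exprVn cN invr1.
have c0 : c != 0 by apply: contraTneq (oner_neq0 K) => c0; rewrite -cN c0 expr0n eqn0Ngt N_gt0 eqxx.
by rewrite E scalerA mulVf ?scale1r.
Qed.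

Lemma commute_uptoM (A B C : 'M[K]_n.+1) :
  commute_upto N A C -> commute_upto N B C -> commute_upto N (A * B) C.
Proof.
move=> [c cN E] [d dN E']; exists (c * d); first by rewrite exprMn cN dN mulr1.
by rewrite -mulmxA E' -scalemxAr mulmxA E -!scalemxAl scalerA mulmxA mulrC.
Qed.

Lemma commute_upto1 (A : 'M[K]_n.+1) : commute_upto N 1 A.
Proof. by exists 1; rewrite ?expr1n // mul1mx mulmx1 scale1r. Qed.

Lemma commute_uptoX (A B : 'M[K]_n.+1) m : commute_upto N A B -> commute_upto N (A ^+ m) B.
Proof.
move=> AB; elim: m => [|m IH]; first by rewrite expr0; apply: commute_upto1.
by rewrite exprS; apply: commute_uptoM.
Qed.

Lemma commute_upto_prod (I : Type) (r : seq I) (F : I -> 'M[K]_n.+1) B :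
  (forall i, commute_upto N (F i) B) -> commute_upto N (\prod_(i <- r) F i) B.
Proof.
move=> FB; apply: (big_ind (fun A => commute_upto N A B)) => //; first exact: commute_upto1.
by move=> A A' *; apply: commute_uptoM.
Qed.

Definition torus_mx (x : 'X_{1..t}) : 'M[K]_n.+1 := \prod_(i < t) g i ^+ x i.

Lemma torus_mx0 : torus_mx 0%MM = 1.
Proof. by rewrite /torus_mx big1 // => i _; rewrite mnmE expr0. Qed.

Lemma torus_mxU i : torus_mx U_(i)%MM = g i.
Proof.
rewrite /torus_mx; have : i \in index_enum 'I_t by rewrite mem_index_enum.
elim: (index_enum 'I_t) (index_enum_uniq 'I_t) => // j r IH /= /andP[jr ur].
rewrite inE big_cons mnmE => /predU1P[->|ir].
  rewrite eqxx expr1 big1_seq ?mulr1 // => l /= lr.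
  by rewrite mnmE (_ : j == l = false) ?expr0 //; apply: contraNF jr => /eqP->.
rewrite (_ : i == j = false) ?expr0 ?mul1r; first exact: IH.
by apply: contraNF jr => /eqP<-.
Qed.

Lemma torus_mx_unit x : torus_mx x \in unitmx.
Proof.
rewrite /torus_mx; apply: (big_ind (fun A : 'M[K]_n.+1 => A \in unitmx)) => [|A B uA uB|i _].
- exact: unitmx1.
- by rewrite -[A * B]/(A *m B) unitmx_mul uA.
by case: g_torus => ug _ _; apply: (@unitrX 'M[K]_n.+1); apply: ug.
Qed.

Lemma torus_mx_comm x y : commute_upto N (torus_mx x) (torus_mx y).
Proof.
case: g_torus => _ cg _.
apply: commute_upto_prod => i; apply: commute_uptoX; apply: commute_upto_sym.
by apply: commute_upto_prod => j; apply: commute_uptoX.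
Qed.

(** The generators commute up to scalars, so that ordered products multiply by adding
    exponents, up to a scalar. *)
Lemma torus_mxD x y : exists2 c : K, c != 0 & torus_mx x * torus_mx y = c *: torus_mx (x + y)%MM.
Proof.
have nz c : c ^+ N = 1 -> c != 0 :> K.
  by move=> cN; apply: contraTneq (oner_neq0 K) => c0; rewrite -cN c0 expr0n eqn0Ngt N_gt0 eqxx.
have -> : torus_mx (x + y)%MM = \prod_(i < t) (g i ^+ x i * g i ^+ y i).
  by apply: eq_bigr => i _; rewrite mnmDE exprD.
rewrite /torus_mx.
elim: (index_enum 'I_t) => [|i r [c c0 IH]].
  by exists 1; rewrite ?oner_neq0 // !big_nil mulr1 scale1r.
rewrite !big_cons; set A := \prod_(j <- r) _ in IH *; set B := \prod_(j <- r) _ in IH *.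
have [d dN E] : commute_upto N A (g i ^+ y i).
  case: g_torus => _ cg _; rewrite /A; apply: (commute_upto_prod _ (F := fun j => g j ^+ x j)) => j.
  by apply: commute_uptoX; apply: commute_upto_sym; apply: commute_uptoX.
exists (d * c); first by rewrite mulf_neq0 ?(nz d).
rewrite -mulrA (mulrA A) [A * _]E -scalerAl -scalerAr -scalerA; congr (_ *: _).
by rewrite -!mulrA IH !scalerAr.
Qed.

Definition torus_term (c : K) (x : 'X_{1..t}) : 'M[{mpoly K[t]}]_n.+1 :=
  'X_[x] *: map_mx (@mpolyC t K) (c *: torus_mx x).

(** The monomial 'X_[x] occurs only with multiples of the single invertible matrix torus_mx x.
    This is why leading coefficients of nonzero elements are invertible. *)
Inductive torus_alg : 'M[{mpoly K[t]}]_n.+1 -> Prop :=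
| torus_alg_term c x : torus_alg (torus_term c x)
| torus_algD M P : torus_alg M -> torus_alg P -> torus_alg (M + P).

Lemma torus_termM c x d y : torus_alg (torus_term c x * torus_term d y).
Proof.
have [u _ E] := torus_mxD x y.
suff -> : torus_term c x * torus_term d y = torus_term (c * d * u) (x + y)%MM.
  exact: torus_alg_term.
rewrite /torus_term -scalerAl -scalerAr scalerA -mpolyXD; congr (_ *: _).
rewrite -[_ * _]/(_ *m _) -map_mxM; congr map_mx.
by rewrite -scalemxAl -scalemxAr [torus_mx x *m _]E !scalerA.
Qed.

Lemma torus_algM M P : torus_alg M -> torus_alg P -> torus_alg (M * P).
Proof.
move=> gM gP; elim: gM => [c x|A B _ IHA _ IHB]; last by rewrite mulrDl; apply: torus_algD.
elim: gP => [d y|A B _ IHA _ IHB]; last by rewrite mulrDr; apply: torus_algD.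
exact: torus_termM.
Qed.

Lemma torus_alg_scalar (c : K) : torus_alg (c%:MP%:M).
Proof.
suff -> : c%:MP%:M = torus_term c 0%MM by exact: torus_alg_term.
by rewrite /torus_term torus_mx0 mpolyX0 scale1r scalemx1 map_scalar_mx.
Qed.

Lemma torus_alg_coef M x : torus_alg M -> exists c, map_mx (mcoeff x) M = c *: torus_mx x.
Proof.
elim=> [c y|A B _ [c Ec] _ [d Ed]]; last first.
  by exists (c + d); rewrite map_mxD Ec Ed scalerDl.
exists (c * (y == x)%:R); apply/matrixP => i j; rewrite !mxE mulrC mcoeffCM mcoeffX.
by case: eqP => [->|_]; rewrite ?mulr1 ?mulr0 ?mul0r.
Qed.

Lemma torus_alg_leads M : torus_alg M -> M != 0 ->
  exists x c, c != 0 /\ leads M x (c *: torus_mx x).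
Proof.
move=> gM /leads_exist [x [e [e0 [Mx Ee]]]]; exists x.
have [c Ec] := torus_alg_coef x gM; exists c; split; last by split.
by apply: contraNneq e0 => c0; rewrite -Ee Ec c0 scale0r.
Qed.

(** The values at the point with all coordinates 1 form an algebra that contains the
    generators. *)
Lemma torus_alg_eval1 (A : 'M[K]_n.+1) :
  exists2 M, torus_alg M & map_mx (meval (fun=> 1)) M = A.
Proof.
case: g_torus => _ _ gen; move: A.
apply: (gen (fun A => exists2 M, torus_alg M & map_mx (meval (fun=> 1)) M = A)).
  split=> [c|A B [M gM <-] [P gP <-]|A B [M gM <-] [P gP <-]].
  - by exists (c%:MP%:M); [apply: torus_alg_scalar | rewrite map_scalar_mx /= mevalC].
  - by exists (M + P); [apply: torus_algD | rewrite map_mxD].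
  - by exists (M * P); [apply: torus_algM | rewrite map_mxM].
move=> i; exists (torus_term 1 U_(i)%MM); first exact: torus_alg_term.
rewrite /torus_term map_mxZ /= mevalXU !scale1r torus_mxU.
by apply/matrixP => j l; rewrite !mxE mevalC.
Qed.

(** The leading coefficient of v is multiplied by an invertible matrix in v *m M. *)
Lemma torus_alg_reg m M (v : 'M[{mpoly K[t]}]_(m, n.+1)) :
  torus_alg M -> M != 0 -> v *m M = 0 -> v = 0.
Proof.
move=> gM M0 vM; apply/row_matrixP => i; rewrite row0; apply: contrapT => /eqP v0.
pose V : 'M[{mpoly K[t]}]_n.+1 := \matrix_(j, l) v i l.
have VM : V * M = 0.
  apply/matrixP => j l; have /matrixP/(_ i l) := vM.
  rewrite [LHS]mxE [(0 : 'M_(_, _)) i l]mxE => E; rewrite [LHS]mxE [RHS]mxE -[RHS]E.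
  by apply: eq_bigr => s _; rewrite mxE.
have V0 : V != 0.
  apply: contraNneq v0 => /matrixP V0; apply/eqP/rowP => l.
  by have := V0 0 l; rewrite !mxE.
have [x [e [e0 Ve]]] := leads_exist V0.
have [y [c [c0 Mc]]] := torus_alg_leads gM M0.
have [_] := leadsM Ve Mc; rewrite VM map_mx0 => E; case/eqP: e0.
have u : c *: torus_mx y \in unitmx by rewrite unitmxZ ?unitfE // torus_mx_unit.
by rewrite -[e](mulmxK u) -[X in X *m _]E mul0mx.
Qed.

End Graded.

(** * Specialization of the generic matrix algebra to a torus *)

Section Specialization.

Variables (k : fieldType) (n m : nat).
Variables (K : fieldType) (iota : {rmorphism k -> K}).
Variables (N t : nat) (g : 'I_t -> 'M[K]_n.+1).
Hypothesis k_inf : infinite_set [set: k]%classic.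
Hypothesis N_gt0 : (0 < N)%N.
Hypothesis g_torus : torus_data N g.

Local Notation tofracX := (@FracField.tofrac (kX k n m)).

Definition generic_poly_mx (s : 'I_m.+2) : 'M[kX k n m]_n.+1 :=
  \matrix_(i, j) kX_var k (s, i, j).

Definition admissible (h : {rmorphism kX k n m -> {mpoly K[t]}}) : Prop :=
  (forall s, torus_alg g (map_mx h (generic_poly_mx s))) /\
  (forall a, h (kX_const n m a) = (iota a)%:MP).

(** Specializing the variables needs polynomial entries, rather than fractions. *)
Lemma generated_lift A : @generated k n m A ->
  exists2 P : 'M[kX k n m]_n.+1, A = map_mx tofracX P &
    forall h, admissible h -> torus_alg g (map_mx h P).
Proof.
elim=> [s|a|B C _ [P -> gP] _ [Q -> gQ]|B C _ [P -> gP] _ [Q -> gQ]].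
- exists (generic_poly_mx s); first by apply/matrixP => i j; rewrite !mxE.
  by move=> h [].
- exists (kX_const n m a)%:M; first by rewrite map_scalar_mx.
  by move=> h [_ hc]; rewrite map_scalar_mx /= hc; apply: (torus_alg_scalar g).
- exists (P + Q); first by rewrite map_mxD.
  by move=> h ah; rewrite map_mxD; apply: torus_algD; [apply: gP | apply: gQ].
exists (P * Q); first by rewrite -[_ * _]/(_ *m _) -[P * Q]/(P *m Q) map_mxM.
move=> h ah; rewrite -[P * Q]/(P *m Q) map_mxM.
by apply: (torus_algM g_torus N_gt0); [apply: gP | apply: gQ].
Qed.

(** A point over k where Q does not vanish gives matrices over K.  They lift to torus_alg, and
    Q does not vanish at the lifted matrices, because it does not once all the variables of
    the torus are set to 1. *)
Lemma admissible_nonzero (Q : kX k n m) : Q != 0 ->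
  exists2 h : {rmorphism kX k n m -> {mpoly K[t]}}, admissible h & h Q != 0.
Proof.
move=> Q0; have [x0 Qx0] := mpoly_nonvanishing k_inf Q0.
pose A s : 'M[K]_n.+1 := \matrix_(i, j) iota (x0 (enum_rank ((s, i, j) : gvar n m))).
have /choice [M HM] s : exists M, torus_alg g M /\ map_mx (meval (fun=> 1)) M = A s.
  by have [M ? ?] := torus_alg_eval1 g_torus N_gt0 (A s); exists M.
pose v (x : 'I_#|gvar n m|) : {mpoly K[t]} :=
  let: (s, i, j) := (enum_val x : gvar n m) in M s i j.
pose h : {rmorphism kX k n m -> {mpoly K[t]}} := mmap ((@mpolyC t K) \o iota) v.
exists h.
  split=> [s|a]; last by rewrite /h /= mmapC.
  suff -> : map_mx h (generic_poly_mx s) = M s by case: (HM s).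
  apply/matrixP => i j; rewrite !mxE /h /= /kX_var mmapX mmap1U /v enum_rankK //.
suff E : (h Q).@[fun=> 1] = iota Q.@[x0].
  apply: contraNneq Qx0 => hQ; move: E; rewrite hQ meval0 => /esym/eqP.
  by rewrite fmorph_eq0.
rewrite /h /= /mmap !raddf_sum /=; apply: eq_bigr => x _.
rewrite mevalM mevalC rmorphM /=; congr (_ * _).
rewrite /mmap1 !rmorph_prod; apply: eq_bigr => i _ /=.
rewrite !rmorphXn /=; congr (_ ^+ _).
have [_ /matrixP] := HM (enum_val i : gvar n m).1.1.
move=> /(_ (enum_val i : gvar n m).1.2 (enum_val i : gvar n m).2).
rewrite !mxE /v; case E: (enum_val i : gvar n m) => [[s a] b] /= ->.
by rewrite -E enum_valK.
Qed.

End Specialization.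

(** * Characters of lattices of rank two *)

(** By the Smith normal form, the lattice spanned by the rows of M has two generators. *)
Lemma int_rowspace_rank2 (m : nat) (M : 'M[int]_(m, 2)) :
  exists (L : 'M[int]_2) (C : 'M[int]_(m, 2)) (E : 'M[int]_(2, m)), M = C *m L /\ L = E *m M.
Proof.
have [P uP [Q uQ [d _ ->]]] := int_Smith_normal_form M.
pose S : 'M[int]_(m, 2) := \matrix_(i, j) (i == j :> nat)%:R.
(* the truncation to j < m makes S^T *m S act as the identity on D even if m < 2 *)
pose D : 'M[int]_2 := diag_mx (\row_j (d`_j *+ (j < m)%N)).
have DE : (\matrix_(i, j) (d`_i *+ (i == j :> nat)) : 'M_(m, 2)) = S *m D.
  apply/matrixP => i j; rewrite mul_mx_diag !mxE; case: eqP => [ij|_]; last by rewrite mul0r.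
  by have := ltn_ord i; rewrite mul1r ij => ->.
have SS : S^T *m (S *m D) = D.
  apply/matrixP => i j; rewrite mul_mx_diag !mxE.
  have [ij|ij] := boolP (i < m)%N; last first.
    rewrite big1 => [|l _].
      by rewrite mulr0n mul0rn.
    rewrite !mxE; case: eqP => [li|_]; rewrite ?mul0r //.
    by move: (ltn_ord l); rewrite li (negbTE ij).
  rewrite (bigD1 (Ordinal ij)) //= big1 => [|l].
    rewrite !mxE /= eqxx mul1r addr0 -[i == j]val_eqE /=.
    by have [<-|_] := eqVneq (i : nat) j; rewrite ?mul0r // mul1r ij.
  rewrite -val_eqE /= => li; by rewrite !mxE (negbTE li) mul0r.
exists (D *m Q), (P *m S), (S^T *m invmx P); split.
  by rewrite DE !mulmxA.
by rewrite -!mulmxA (mulmxA (invmx P)) mulVmx // mul1mx DE -mulmxA -{1}SS !mulmxA.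
Qed.

Section Characters.

Variables (K : fieldType) (alpha beta : K).
Hypotheses (alpha0 : alpha != 0) (beta0 : beta != 0).

Definition lattice_char (v : 'rV[int]_2) : K := alpha ^ v 0 0 * beta ^ v 0 1.

Lemma lattice_char_sum (r : nat) (c : 'I_r -> int) (v : 'I_r -> 'rV[int]_2) :
  lattice_char (\sum_s c s *: v s) = \prod_s lattice_char (v s) ^ c s.
Proof.
have H (x : K) j : x != 0 -> x ^ ((\sum_s c s *: v s) 0 j) = \prod_s (x ^ v s 0 j) ^ c s.
  move=> x0; rewrite summxE (big_morph (fun y => x ^ y) (id1 := 1) (op1 := *%R)) //.
    by apply: eq_bigr => s _; rewrite mxE exprz_exp mulrC.
  by move=> y y'; rewrite expfzDr.
rewrite /lattice_char !H // -big_split; apply: eq_bigr => s _ /=.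
by rewrite expfzMl.
Qed.

End Characters.

Lemma mulmx_rows (m r : nat) (A : 'M[int]_(m, r)) (B : 'M[int]_(r, 2)) i :
  row i (A *m B) = \sum_s A i s *: row s B.
Proof.
rewrite row_mul mulmx_sum_row; apply: eq_bigr => s _; by rewrite mxE.
Qed.

Section Pigeonhole.

Variables (K : fieldType) (p : nat) (I : finType) (m : nat).
Variables (alpha beta : I -> K) (a b : 'I_m -> nat).
Hypothesis p_gt0 : (0 < p)%N.
Hypothesis I_gt : (p ^ 2 < #|I|)%N.
Hypothesis alpha0 : forall i, alpha i != 0.
Hypothesis beta0 : forall i, beta i != 0.
Hypothesis root1 : forall i j, (alpha i ^+ a j * beta i ^+ b j) ^+ p = 1.

(** On the lattice spanned by the vectors (a j, b j) the characters are determined by their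
    values at two generators, which are p-th roots of unity; there are at most p ^ 2 pairs of
    those. *)
Lemma characters_collide : exists i i', i != i' /\
  forall j, alpha i ^+ a j * beta i ^+ b j = alpha i' ^+ a j * beta i' ^+ b j.
Proof.
pose M : 'M[int]_(m, 2) := \matrix_(j, s) (if s == ord0 then (a j)%:Z else (b j)%:Z).
have [L [C [E [MC LE]]]] := int_rowspace_rank2 M.
pose chi i := lattice_char (alpha i) (beta i).
have chiM i j : chi i (row j M) = alpha i ^+ a j * beta i ^+ b j.
  by rewrite /chi /lattice_char !mxE.
pose f i := (chi i (row 0 L), chi i (row 1 L)).
have chi_p i s : chi i (row s L) ^+ p = 1.
  rewrite LE mulmx_rows /chi lattice_char_sum // -prodrXl big1 // => j _.
  rewrite [LHS]exprnP exprz_exp [E s j * _]mulrC -exprz_exp -(exprnP _ p).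
  by rewrite [lattice_char _ _ _]chiM root1 exp1rz.
have fp i : ((f i).1 ^+ p = 1) /\ ((f i).2 ^+ p = 1) by split; apply: chi_p.
have fE i i' : f i = f i' -> forall j,
    alpha i ^+ a j * beta i ^+ b j = alpha i' ^+ a j * beta i' ^+ b j.
  case=> E0 E1 j; rewrite -!chiM MC mulmx_rows /chi !lattice_char_sum //.
  by rewrite !big_ord_recl !big_ord0 (_ : lift ord0 ord0 = 1)
     ?[lattice_char _ _ (row ord0 L)]E0 ?[lattice_char _ _ (row 1 L)]E1 //; apply: val_inj.
suff /injectivePn[i [i' ii' Ef]] : ~~ injectiveb f by exists i, i'; split=> //; apply: fE.
apply/negP => /injectiveP injf.
pose s1 := undup [seq (f i).1 | i <- enum I]; pose s2 := undup [seq (f i).2 | i <- enum I].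
have sz (h : I -> K) : (forall i, h i ^+ p = 1) ->
    (size (undup [seq h i | i <- enum I]) <= p)%N.
  move=> h1; apply: max_unity_roots => //; last exact: undup_uniq.
  apply/allP => x; rewrite mem_undup => /mapP[i _ ->].
  by rewrite unity_rootE h1.
have : (#|I| <= size (allpairs pair s1 s2))%N.
  rewrite cardE -(size_map f); apply: uniq_leq_size; first by rewrite map_inj_uniq ?enum_uniq.
  move=> _ /mapP[i iI ->]; rewrite [f i]surjective_pairing; apply: allpairs_f; rewrite mem_undup.
    exact: (map_f (fun i => (f i).1) iI).
  exact: (map_f (fun i => (f i).2) iI).
rewrite size_allpairs; apply/negP; rewrite -ltnNge (leq_ltn_trans _ I_gt) //.
by rewrite -mulnn leq_mul //; apply: sz => // i; case: (fp i).
Qed.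

End Pigeonhole.

(** * Identities that tori exclude *)

Section Obstructions.

Variables (k : fieldType) (n m : nat).
Variables (K : fieldType) (iota : {rmorphism k -> K}).
Variables (N t : nat) (g : 'I_t -> 'M[K]_n.+1).
Hypothesis k_inf : infinite_set [set: k]%classic.
Hypothesis N_gt0 : (0 < N)%N.
Hypothesis g_torus : torus_data N g.

Local Notation tofracX := (@FracField.tofrac (kX k n m)).
Local Notation gen := (@generated k n m).

Lemma tofrac_mx_inj a b : injective (map_mx tofracX : 'M_(a, b) -> 'M_(a, b)).
Proof.
move=> A B /matrixP E; apply/matrixP => i j; have := E i j; rewrite !mxE.
by move/eqP; rewrite tofrac_eq => /eqP.
Qed.

(** One nonzero entry is chosen in each b j, and the product of the choices is kept nonzero. *)
Lemma generated_specialize (J : finType) (b : J -> 'M[kXf k n m]_n.+1) :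
  (forall j, gen (b j)) -> (forall j, b j != 0) ->
  exists (P : J -> 'M[kX k n m]_n.+1) (h : {rmorphism kX k n m -> {mpoly K[t]}}),
    (forall j, b j = map_mx tofracX (P j)) /\
    (forall j, torus_alg g (map_mx h (P j)) /\ map_mx h (P j) != 0).
Proof.
move=> gb b0.
have /choice [P HP] j : exists P : 'M[kX k n m]_n.+1, b j = map_mx tofracX P /\
    (forall h, admissible iota g h -> torus_alg g (map_mx h P)).
  by have [P ? ?] := generated_lift iota N_gt0 g_torus (gb j); exists P.
have /choice [e He] j : exists ij : 'I_n.+1 * 'I_n.+1, P j ij.1 ij.2 != 0.
  apply: contrapT => nex; case/eqP: (b0 j); have [-> _] := HP j.
  apply/matrixP => i l; rewrite !mxE; apply/eqP; rewrite tofrac_eq0.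
  by apply: contrapT => /negP nz; apply: nex; exists (i, l).
have Q0 : \prod_j P j (e j).1 (e j).2 != 0 by apply/prodf_neq0 => j _.
have [h ah hQ] := admissible_nonzero iota k_inf N_gt0 g_torus Q0.
exists P, h; split=> j; first by case: (HP j).
split; first by have [_ ] := HP j; apply.
apply: contraNneq hQ => /matrixP/(_ (e j).1 (e j).2); rewrite !mxE => E.
by rewrite (bigD1 j) //= rmorphM /= E mul0r.
Qed.

Lemma generated_unit A : gen A -> A != 0 -> A \in unitmx.
Proof.
move=> gA A0.
have [P [h [EP hP]]] := @generated_specialize unit (fun=> A) (fun=> gA) (fun=> A0).
have [gh h0] := hP tt; rewrite unitmxE unitfE (EP tt) det_map_mx tofrac_eq0.
apply: contraNneq h0 => detP; apply/eqP.
have /det0P [v v0 vP] : \det (map_mx h (P tt)) == 0 by rewrite det_map_mx detP rmorph0.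
apply: contraNeq v0 => h0; apply/eqP.
exact: (torus_alg_reg g_torus gh h0 vP).
Qed.

Lemma commuteX_upto (A B : 'M[K]_n.+1) c d : A * B = c *: (B * A) ->
  A ^+ d * B = c ^+ d *: (B * A ^+ d).
Proof.
move=> E; elim: d => [|d IH]; first by rewrite !expr0 mul1r mulr1 scale1r.
have -> : A ^+ d.+1 * B = A * (A ^+ d * B) by rewrite exprS mulrA.
by rewrite IH -scalerAr (mulrA A) E -scalerAl scalerA -mulrA -exprS -exprSr.
Qed.

Lemma commute_scale (A B : 'M[K]_n.+1) w c d : A * B = w *: (B * A) ->
  (c *: A) * (d *: B) = w *: ((d *: B) * (c *: A)).
Proof.
move=> E; rewrite -!scalerAl -!scalerAr E !scalerA; congr (_ *: _).
by rewrite mulrC (mulrC c) mulrA.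
Qed.

(** Commutation factors in the torus are N-th roots of unity, so that the leading
    coefficients of u ^+ N and y commute. *)
Lemma generated_exponent u y d : gen u -> gen y -> u != 0 -> y != 0 ->
  \sum_(i < d) (u ^+ N) ^+ i * y * (u ^+ N) ^+ (d.-1 - i) = 0 -> d%:R = 0 :> k.
Proof.
move=> gu gy u0 y0 sum0.
have [P [h [EP hP]]] : exists (P : bool -> 'M[kX k n m]_n.+1)
    (h : {rmorphism kX k n m -> {mpoly K[t]}}),
    (forall j : bool, (if j then u else y) = map_mx tofracX (P j)) /\
    (forall j, torus_alg g (map_mx h (P j)) /\ map_mx h (P j) != 0).
  by apply: generated_specialize => -[].
have [gU U0] := hP true; have [gY Y0] := hP false.
have [x [c [c0 Ux]]] := torus_alg_leads gU U0.
have [x' [c' [c'0 Yx]]] := torus_alg_leads gY Y0.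
have uE z w : z != 0 -> z *: torus_mx g w \in unitmx.
  by move=> z0; rewrite unitmxZ ?unitfE // (torus_mx_unit g_torus).
apply/eqP; rewrite -(fmorph_eq0 iota) rmorph_nat; apply/eqP.
apply: (leads_conj_sum (e := (c *: torus_mx g x) ^+ N) _ (uE _ x' c'0) _ (leadsX N Ux) Yx).
- by apply: (@unitrX 'M[K]_n.+1); apply: uE.
- have [w wN E] := torus_mx_comm g_torus N_gt0 x x'.
  rewrite (commuteX_upto N (c := w)) ?wN ?scale1r //.
  exact: commute_scale.
have E0 : \sum_(i < d) (P true ^+ N) ^+ i * P false * (P true ^+ N) ^+ (d.-1 - i) = 0.
  apply: tofrac_mx_inj; rewrite map_mx0 -sum0 rmorph_sum; apply: eq_bigr => i _.
  by rewrite !rmorphM !rmorphXn /= -!EP.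
have := congr1 (map_mx h) E0; rewrite map_mx0 rmorph_sum; apply: etrans; apply: eq_bigr => i _.
by rewrite !rmorphM !rmorphXn.
Qed.

End Obstructions.

Section RankTwo.

Variables (k : fieldType) (n m : nat).
Variables (K : fieldType) (iota : {rmorphism k -> K}) (z : K).
Hypothesis k_inf : infinite_set [set: k]%classic.
Hypothesis z_prim : n.+1.-primitive_root z.

Local Notation gen := (@generated k n m).
Local Notation tofracX := (@FracField.tofrac (kX k n m)).

(** The leading coefficient of u i commutes with torus_mx y up to the value at the exponent y
    of a character of the lattice of rank two.  As u i ^+ p commutes with the y j, these values
    are p-th roots of unity at the leading exponents of the y j.  Hence two of the characters
    agree there, and then the leading coefficients of w and of y (rho i i') commute. *)
Lemma generated_rank2 (p : nat) (I J : finType) (rho : I -> I -> J)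
    (u : I -> 'M[kXf k n m]_n.+1) (y : J -> 'M[kXf k n m]_n.+1) :
  (0 < p)%N -> (p ^ 2 < #|I|)%N ->
  (forall i, gen (u i) /\ u i != 0) -> (forall j, gen (y j) /\ y j != 0) ->
  (forall i j, u i ^+ p * y j = y j * u i ^+ p) ->
  (forall i i', i != i' -> let w := u i ^+ p.-1 * u i' in
     \sum_(l < p) w ^+ l * y (rho i i') * w ^+ (p.-1 - l) = 0) ->
  p%:R = 0 :> k.
Proof.
move=> p0 Ip Hu Hy Cuy Suy.
have gT := torus_data_clock_shift z_prim.
pose b (x : I + J) := match x with inl i => u i | inr j => y j end.
have [P [h [EP hP]]] : exists (P : I + J -> 'M[kX k n m]_n.+1)
    (h : {rmorphism kX k n m -> {mpoly K[2]}}),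
    (forall j, b j = map_mx tofracX (P j)) /\
    (forall j, torus_alg (clock_shift n z) (map_mx h (P j)) /\ map_mx h (P j) != 0).
  apply: (generated_specialize iota k_inf _ gT) => // -[j|j]; rewrite /b;
    by [case: (Hu j)|case: (Hy j)].
set g := clock_shift n z in gT hP.
have /choice [x Hx] j : exists x, exists c, c != 0 /\ leads (map_mx h (P j)) x (c *: torus_mx g x).
  by have [gj j0] := hP j; apply: torus_alg_leads.
have {Hx} /choice [c Hc] j := Hx j.
pose e j := c j *: torus_mx g (x j).
have ue j : e j \in unitmx.
  by rewrite unitmxZ ?unitfE ?(torus_mx_unit gT) //; case: (Hc j).
have Le j : leads (map_mx h (P j)) (x j) (e j) by case: (Hc j).
have nzr (a : K) : a ^+ n.+1 = 1 -> a != 0.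
  by move=> aN; apply: contraTneq (oner_neq0 K) => a0; rewrite -aN a0 expr0n eqxx.
have /choice [al Hal] i : exists a : 'I_2 -> K,
    forall s, a s != 0 /\ e (inl i) * g s = a s *: (g s * e (inl i)).
  suff /choice : forall s, exists a : K, a != 0 /\ e (inl i) * g s = a *: (g s * e (inl i)).
    by move=> [a Ha]; exists a.
  move=> s; have [a aN E] := torus_mx_comm gT (ltn0Sn n) (x (inl i)) U_(s)%MM.
  exists a; split; first exact: nzr.
  rewrite torus_mxU in E.
  by rewrite /e -scalerAl -scalerAr [torus_mx g _ * _]E !scalerA mulrC.
have comm i j : e (inl i) * e (inr j) =
    (al i 0 ^+ x (inr j) 0 * al i 1 ^+ x (inr j) 1) *: (e (inr j) * e (inl i)).
  have gX s d : e (inl i) * g s ^+ d = al i s ^+ d *: (g s ^+ d * e (inl i)).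
    have [a0 E] := Hal i s.
    have E' : g s * e (inl i) = (al i s)^-1 *: (e (inl i) * g s).
      by rewrite E scalerA mulVf ?scale1r.
    by rewrite (commuteX_upto d E') scalerA -exprMn divff // expr1n scale1r.
  have -> : e (inr j) = c (inr j) *: (g 0 ^+ x (inr j) 0 * g 1 ^+ x (inr j) 1).
    rewrite /e /torus_mx !big_ord_recl big_ord0 mulr1.
    by rewrite (_ : lift ord0 ord0 = 1) //; apply: val_inj.
  rewrite -[e (inl i)]scale1r; apply: commute_scale.
  rewrite mulrA [e (inl i) * g 0 ^+ _]gX -scalerAl -[_ * e _ * _]mulrA.
  by rewrite [e (inl i) * g 1 ^+ _]gX -scalerAr scalerA mulrA.
have id1 i j : (al i 0 ^+ x (inr j) 0 * al i 1 ^+ x (inr j) 1) ^+ p = 1.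
  have E0 : P (inl i) ^+ p * P (inr j) = P (inr j) * P (inl i) ^+ p.
    by apply: tofrac_mx_inj; rewrite !(rmorphM, rmorphXn) /= -!EP; apply: Cuy.
  have [_ E1] := leadsM (leadsX p (Le (inl i))) (Le (inr j)).
  have [_ E2] := leadsM (Le (inr j)) (leadsX p (Le (inl i))).
  have E3 : e (inl i) ^+ p * e (inr j) = e (inr j) * e (inl i) ^+ p.
    rewrite -E1 -E2 addmC; congr map_mx.
    by have := congr1 (map_mx h) E0; rewrite !(rmorphM, rmorphXn).
  move: E3; rewrite (commuteX_upto p (comm i j)).
  set U := _ * e _ ^+ _; set a := _ ^+ p => E3.
  have uU : U \in unitmx.
    rewrite /U -[_ * _]/(_ *m _) unitmx_mul ue; exact: (@unitrX 'M[K]_n.+1).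
  have /eqP := congr1 (fun A => A *m invmx U) E3.
  rewrite -scalemxAl mulmxV // -subr_eq0 -[X in _ - X]scale1r -scalerBl.
  by rewrite scaler_eq0 (negbTE (matrix_nonzero1 _ _)) orbF subr_eq0 => /eqP.
have [i [i' [ii' Ei]]] := characters_collide (a := fun j : 'I_#|J| => x (inr (enum_val j)) 0)
   (b := fun j => x (inr (enum_val j)) 1) p0 Ip
   (fun i => proj1 (Hal i 0)) (fun i => proj1 (Hal i 1)) (fun i j => id1 i (enum_val j)).
have {}Ei j : al i 0 ^+ x (inr j) 0 * al i 1 ^+ x (inr j) 1 =
    al i' 0 ^+ x (inr j) 0 * al i' 1 ^+ x (inr j) 1.
  by have := Ei (enum_rank j); rewrite enum_rankK.
apply/eqP; rewrite -(fmorph_eq0 iota) rmorph_nat; apply/eqP.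
pose j := rho i i'.
have Lw := leadsM (leadsX p.-1 (Le (inl i))) (Le (inl i')).
apply: (leads_conj_sum _ (ue (inr j)) _ Lw (Le (inr j))).
- rewrite -[_ * _]/(_ *m _) unitmx_mul ue andbT; apply: (@unitrX 'M[K]_n.+1); exact: ue.
- rewrite -mulrA (comm i') -scalerAr mulrA (commuteX_upto _ (comm i j)) -scalerAl scalerA -Ei.
  by rewrite -exprS prednK // id1 scale1r mulrA.
have E0 : \sum_(l < p) (P (inl i) ^+ p.-1 * P (inl i')) ^+ l * P (inr j) *
     (P (inl i) ^+ p.-1 * P (inl i')) ^+ (p.-1 - l) = 0.
  apply: tofrac_mx_inj; rewrite map_mx0 -(Suy _ _ ii') rmorph_sum; apply: eq_bigr => l _.
  by rewrite !(rmorphM, rmorphXn) /= -!EP.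
have := congr1 (map_mx h) E0; rewrite map_mx0 rmorph_sum; apply: etrans; apply: eq_bigr => l _.
by rewrite !(rmorphM, rmorphXn).
Qed.

End RankTwo.

(** * Capelli sums *)

Section Capelli.

Variables (R : comNzRingType) (n : nat).
Local Notation N := (n.+1 * n.+1)%N.
Implicit Types (x y z : 'I_N -> 'M[R]_n.+1).

Lemma prod_sum_scale (I T : finType) (c : I -> T -> R) (v : I -> T -> 'M[R]_n.+1) :
  \prod_i \sum_t c i t *: v i t =
  \sum_(f : {ffun I -> T}) (\prod_i c i (f i)) *: \prod_i v i (f i).
Proof. by rewrite bigA_distr_bigA; apply: eq_bigr => f _; rewrite scaler_prod. Qed.

(** The Capelli polynomial, alternating in the x i; each slot around an x i is filled by a left
    factor y i and a right factor z i, which are kept apart so that single entries of x i can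
    be isolated. *)
Definition capelli y z x : 'M[R]_n.+1 :=
  \sum_(s : 'S_N) (-1) ^+ s *: \prod_i (y i * x (s i) * z i).

Definition coord_mx x : 'M[R]_N := \matrix_i mxvec (x i).

Definition unit_family (i : 'I_N) : 'M[R]_n.+1 := vec_mx (delta_mx 0 i).

Lemma coord_mx_unit : coord_mx unit_family = 1%:M.
Proof. by apply/row_matrixP => i; rewrite rowK vec_mxK row1. Qed.

(** In matrix units, the alternating sum becomes a sum, over all selections f of columns, of
    the determinant of coord_mx x with its columns selected by f. *)
Lemma capelli_det y z x : capelli y z x = \det (coord_mx x) *: capelli y z unit_family.
Proof.
pose S (f : {ffun 'I_N -> 'I_N}) : 'M[R]_N := \matrix_(j, l) (j == f l)%:R.
pose Z (f : {ffun 'I_N -> 'I_N}) := \prod_i (y i * unit_family (f i) * z i).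
suff E x' : capelli y z x' =
    \sum_(f : {ffun 'I_N -> 'I_N}) (\det (coord_mx x') * \det (S f)) *: Z f.
  rewrite !E scaler_sumr; apply: eq_bigr => f _.
  by rewrite coord_mx_unit det1 mul1r scalerA.
have xE i : x' i = \sum_j coord_mx x' i j *: unit_family j.
  rewrite -[LHS]mxvecK [mxvec _]row_sum_delta linear_sum; apply: eq_bigr => j _.
  by rewrite linearZ /= mxE.
rewrite /capelli.
have termE (s : 'S_N) : \prod_i (y i * x' (s i) * z i) =
    \sum_(f : {ffun 'I_N -> 'I_N}) (\prod_i coord_mx x' (s i) (f i)) *: Z f.
  rewrite -(prod_sum_scale (fun i j => coord_mx x' (s i) j) (fun i j => y i * unit_family j * z i)).
  apply: eq_bigr => i _.
  rewrite xE mulr_sumr mulr_suml; apply: eq_bigr => j _.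
  by rewrite -scalerAr -scalerAl.
under eq_bigr => s _ do rewrite termE scaler_sumr.
rewrite exchange_big; apply: eq_bigr => f _ /=.
under eq_bigr => s _ do rewrite scalerA.
rewrite -scaler_suml; congr (_ *: _).
rewrite -det_mulmx -det_tr; apply: eq_bigr => s _; congr (_ * _).
apply: eq_bigr => i _; rewrite !mxE (bigD1 (f i)) //= big1 => [|j jf].
  by rewrite !mxE eqxx mulr1 addr0.
by rewrite !mxE (negbTE jf) mulr0.
Qed.

Definition index_pair (i : 'I_N) : 'I_n.+1 * 'I_n.+1 :=
  enum_val (cast_ord (esym (mxvec_cast n.+1 n.+1)) i).

Lemma index_pairK i : mxvec_index (index_pair i).1 (index_pair i).2 = i.
Proof.
by rewrite /mxvec_index -surjective_pairing /index_pair enum_valK cast_ordKV.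
Qed.

Lemma index_pairP : cancel index_pair (fun p => mxvec_index p.1 p.2).
Proof. exact: index_pairK. Qed.

(** Here y i * x * z i is the entry of x at the place i, put in the corner, so that only
    the identity permutation contributes. *)
Lemma capelli_delta :
  capelli (fun i => delta_mx 0 (index_pair i).1) (fun i => delta_mx (index_pair i).2 0)
    unit_family = delta_mx 0 0.
Proof.
have fE i j : delta_mx 0 (index_pair i).1 * unit_family j * delta_mx (index_pair i).2 0 =
    (j == i)%:R *: delta_mx 0 0 :> 'M[R]_n.+1.
  have -> : unit_family j = delta_mx (index_pair j).1 (index_pair j).2.
    by rewrite /unit_family -{1}(index_pairK j) vec_mx_delta.
  have dd a b c d : delta_mx a b * delta_mx c d = delta_mx a d *+ (b == c) :> 'M[R]_n.+1.
    exact: mul_delta_mx_cond.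
  rewrite dd mulrnAl dd -mulrnA mulnb.
  rewrite scaler_nat; congr (_ *+ _); rewrite andbC eq_sym -xpair_eqE -!surjective_pairing.
  by rewrite (can_eq index_pairP).
rewrite /capelli (bigD1 1%g) //= [X in _ + X]big1 => [|s s1].
  rewrite odd_perm1 expr0 scale1r addr0.
  under eq_bigr => i _ do rewrite fE perm1 eqxx scale1r.
  rewrite prodr_const card_ord.
  have E : delta_mx 0 0 * delta_mx 0 0 = delta_mx 0 0 :> 'M[R]_n.+1.
    by rewrite -[_ * _]/(_ *m _) mul_delta_mx.
  have -> : N = (n + n * n.+1).+1 by [].
  by elim: (n + n * n.+1)%N => [|d IH]; rewrite ?expr1 // exprS IH E.
have [i si] : exists i, s i != i.
  apply: contrapT => nex; case/eqP: s1; apply/permP => i; rewrite perm1.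
  by apply: contrapT => /eqP h; apply: nex; exists i.
under eq_bigr => j _ do rewrite fE.
rewrite scaler_prod (bigD1 i) //= (negbTE si) mul0r scale0r scaler0 //.
Qed.

(** A Capelli sum is multilinear in the families y and z. *)
Lemma capelli_span (T : finType) (w : T -> 'M[R]_n.+1) y z x :
  (forall A, exists c, A = \sum_t c t *: w t) ->
  (forall f g : 'I_N -> T, capelli (w \o f) (w \o g) x = 0) -> capelli y z x = 0.
Proof.
move=> span cap0.
have /choice [p Hp] i := span (y i). have /choice [q Hq] i := span (z i).
have termE (s : 'S_N) : \prod_i (y i * x (s i) * z i) =
  \sum_(f : {ffun 'I_N -> T * T}) (\prod_i (p i (f i).1 * q i (f i).2)) *:
     \prod_i (w (f i).1 * x (s i) * w (f i).2).
  rewrite -(prod_sum_scale (fun i t => p i t.1 * q i t.2) (fun i t => w t.1 * x (s i) * w t.2)).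
  apply: eq_bigr => i _; rewrite {1}Hp {1}Hq mulr_suml big_distrlr /= pair_big /=.
  by apply: eq_bigr => t _; rewrite -!scalerAl -scalerAr scalerA.
rewrite /capelli; under eq_bigr => s _ do rewrite termE scaler_sumr.
rewrite exchange_big big1 // => f _ /=.
under eq_bigr => s _ do rewrite scalerA mulrC -scalerA.
rewrite -scaler_sumr.
have := cap0 (fun i => (f i).1) (fun i => (f i).2); rewrite /capelli /= => ->.
by rewrite scaler0.
Qed.

End Capelli.

Arguments unit_family {R n} i.

Lemma capelli_map (R S : comNzRingType) (n : nat) (f : {rmorphism R -> S})
    (y z x : 'I_(n.+1 * n.+1) -> 'M[R]_n.+1) :
  map_mx f (capelli y z x) =
  capelli (fun i => map_mx f (y i)) (fun i => map_mx f (z i)) (fun i => map_mx f (x i)).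
Proof.
rewrite /capelli rmorph_sum; apply: eq_bigr => s _.
rewrite /= map_mxZ rmorphXn rmorphN1 rmorph_prod; congr (_ *: _).
by apply: eq_bigr => i _; rewrite !rmorphM.
Qed.

Lemma unit_family_map (R S : comNzRingType) (n : nat) (f : {rmorphism R -> S}) i :
  map_mx f (unit_family i : 'M[R]_n.+1) = unit_family i.
Proof. by rewrite /unit_family map_vec_mx map_delta_mx. Qed.

(** * Division in the generic matrix algebra *)

Lemma Cayley_Hamilton_sum (R : comNzRingType) (d : nat) (L : 'M[R]_d.+1) :
  \sum_(j < d.+2) (char_poly L)`_j *: L ^+ j = 0.
Proof.
have CH := Cayley_Hamilton L.
rewrite -[RHS]CH /horner_mx /= /horner_morph (@horner_coef_wide _ d.+2).
  by apply: eq_bigr => j _; rewrite coef_map /= -[_ * _]/(_ *m _) mul_scalar_mx.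
by rewrite -(size_char_poly L) size_poly.
Qed.

(** This is the theorem of Cayley and Hamilton for L, applied to v 1. *)
Lemma char_poly_action (R : comNzRingType) (n d : nat) (A : 'M[R]_n.+1) (L : 'M[R]_d.+1)
    (v : {linear 'M[R]_n.+1 -> 'rV[R]_d.+1}) :
  injective v -> (forall B, v B *m L = v (A * B)) ->
  \sum_(j < d.+2) (char_poly L)`_j *: A ^+ j = 0.
Proof.
move=> vI vL; apply: vI; rewrite linear0 linear_sum.
have vX j : v (A ^+ j) = v 1 *m L ^+ j.
  elim: j => [|j IH]; first by rewrite !expr0 mulmx1.
  by rewrite exprS -vL IH -mulmxA exprSr.
under eq_bigr => j _ do rewrite linearZ /= vX scalemxAr.
by rewrite -mulmx_sumr Cayley_Hamilton_sum mulmx0.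
Qed.

Lemma scale_square_exp (R : comNzRingType) (A : algType R) (a b : R) (x : A) l :
  a *: (b *: (x ^+ 2) ^+ l.+1) = (a *: x) * (b *: x) * (x ^+ 2) ^+ l.
Proof. by rewrite -!(scalerAl, scalerAr) exprS {1}expr2. Qed.

Section GenericDivision.

Variables (k : fieldType) (n m : nat).
Local Notation Om := (kXf k n m).
Local Notation gen := (@generated k n m).
Local Notation N := (n.+1 * n.+1)%N.
Implicit Types A B : 'M[Om]_n.+1.

Hypothesis gen_unit : forall A, gen A -> A != 0 -> A \in unitmx.

Lemma gen0 : gen 0.
Proof. by apply/genericP; rewrite rpred0. Qed.
Lemma gen1 : gen 1.
Proof. by apply/genericP; rewrite rpred1. Qed.
Lemma genN A : gen A -> gen (- A).
Proof. by move=> /genericP gA; apply/genericP; rewrite rpredN. Qed.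
Lemma genX A d : gen A -> gen (A ^+ d).
Proof. by move=> /genericP gA; apply/genericP; rewrite rpredX. Qed.
Lemma gen_sum (I : Type) (r : seq I) (P : pred I) (F : I -> 'M[Om]_n.+1) :
  (forall i, P i -> gen (F i)) -> gen (\sum_(i <- r | P i) F i).
Proof. by move=> gF; apply/genericP; apply: rpred_sum => i Pi; apply/genericP/gF. Qed.

(** Polynomials with coefficients in the generic matrix algebra, written as matrices of
    polynomials. *)
Definition genpoly (A : 'M[{poly Om}]_n.+1) : Prop := forall j, gen (map_mx (coefp j) A).

Lemma genpolyD (A B : 'M[{poly Om}]_n.+1) : genpoly A -> genpoly B -> genpoly (A + B).
Proof. by move=> gA gB j; rewrite map_mxD; apply: Gen_add; [apply: gA|apply: gB]. Qed.

Lemma genpolyN (A : 'M[{poly Om}]_n.+1) : genpoly A -> genpoly (- A).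
Proof. by move=> gA j; rewrite map_mxN; apply/genN/gA. Qed.

Lemma genpolyM (A B : 'M[{poly Om}]_n.+1) : genpoly A -> genpoly B -> genpoly (A * B).
Proof.
move=> gA gB j.
have -> : map_mx (coefp j) (A * B) =
    \sum_(i < j.+1) map_mx (coefp i) A * map_mx (coefp (j - i)) B.
  apply/matrixP => a b; rewrite summxE !mxE /= coef_sum.
  rewrite (eq_bigr _ (fun l _ => coefM (A a l) (B l b) j)).
  rewrite exchange_big; apply: eq_bigr => i _; rewrite mxE.
  by apply: eq_bigr => l _; rewrite !mxE.
by apply: gen_sum => i _; apply: Gen_mul; [apply: gA|apply: gB].
Qed.

Lemma genpolyC A : gen A -> genpoly (map_mx polyC A).
Proof.
move=> gA [|j].
  by rewrite (_ : map_mx _ _ = A) //; apply/matrixP => a b; rewrite !mxE /= coefC.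
by rewrite (_ : map_mx _ _ = 0); [exact: gen0 | apply/matrixP => a b; rewrite !mxE /= coefC].
Qed.

Lemma genpolyX : genpoly 'X%:M.
Proof.
move=> j; have -> : map_mx (coefp j) 'X%:M = if j == 1%N then 1 else 0 :> 'M[Om]_n.+1.
  by apply/matrixP => a b; rewrite !mxE /= coefMn coefX; case: (j == 1%N); rewrite !mxE ?mul0rn.
by case: (j == 1%N); [exact: gen1 | exact: gen0].
Qed.

Lemma genpoly_capelli (y z x : 'I_N -> 'M[{poly Om}]_n.+1) :
  (forall i, genpoly (y i)) -> (forall i, genpoly (z i)) -> (forall i, genpoly (x i)) ->
  genpoly (capelli y z x).
Proof.
move=> gy gz gx; have g1 : genpoly 1.
  by have := genpolyC gen1; rewrite (rmorph1 (map_mx polyC)).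
apply: (big_ind genpoly) => [|A B|s _]; last 1 first.
- have gp : genpoly (\prod_i (y i * x (s i) * z i)).
    apply: (big_ind genpoly) => // [A B|i _]; first exact: genpolyM.
    by do 2?apply: genpolyM.
  rewrite -signr_odd; case: (odd s); rewrite ?expr1 ?expr0 ?scaleN1r ?scale1r //.
  exact: genpolyN.
- by have := genpolyC gen0; rewrite map_mx0.
exact: genpolyD.
Qed.

Definition word (t : 'I_n.+1 * 'I_n.+1) : 'M[Om]_n.+1 :=
  generic_mx k n (ord0 : 'I_m.+2) ^+ (n - t.1) * generic_mx k n (lift ord0 ord0 : 'I_m.+2) *
  generic_mx k n (ord0 : 'I_m.+2) ^+ t.2.

Lemma gen_word t : gen (word t).
Proof.
by apply: Gen_mul; first apply: Gen_mul; try apply: genX; apply: Gen_generic.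
Qed.

Lemma word_span A : exists c, A = \sum_t c t *: word t.
Proof.
have [c ->] := generic_span A; exists (fun t => c t.1 t.2).
by rewrite pair_big.
Qed.

Definition words (i : 'I_N) := word (index_pair i).

Lemma words_unit : coord_mx words \in unitmx.
Proof.
have /choice [c Hc] i := word_span (unit_family i).
pose C : 'M[Om]_N := \matrix_(i, j) c i (index_pair j).
have : C *m coord_mx words = 1%:M.
  rewrite -coord_mx_unit; apply/row_matrixP => i; rewrite row_mul rowK [in RHS]Hc.
  rewrite mulmx_sum_row linear_sum (reindex (index_pair (n := n))) /=.
    by apply: eq_bigr => j _; rewrite rowK !mxE linearZ.
  exists (fun p => mxvec_index p.1 p.2) => p _; first exact: index_pairK.
  by case: p => a b; rewrite /index_pair /mxvec_index cast_ordK enum_rankK.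
by move/mulmx1_unit => [].
Qed.

Lemma capelli_gen_neq0 : exists y z : 'I_N -> 'M[Om]_n.+1,
  [/\ forall i, gen (y i), forall i, gen (z i) & capelli y z unit_family != 0].
Proof.
apply: contrapT => nex.
have : capelli (fun i => delta_mx 0 (index_pair i).1) (fun i => delta_mx (index_pair i).2 0)
    unit_family = 0 :> 'M[Om]_n.+1.
  apply: (capelli_span _ _ word_span) => f g; apply: contrapT => /eqP nz; apply: nex.
  by exists (word \o f), (word \o g); split=> // i; apply: gen_word.
by rewrite capelli_delta => /matrixP/(_ 0 0)/eqP; rewrite !mxE !eqxx oner_eq0.
Qed.

(** This power of the characteristic polynomial of A is used because it is a determinant of
    size N, like the one in a Capelli sum. *)
Definition regular_char_poly A := char_poly (lin_mulmx A : 'M[Om]_N).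

(** W is a Capelli sum in words, that is, a determinant times a fixed matrix.  When each word w
    is replaced by ('X - A) * w, the determinant gets multiplied by the characteristic
    polynomial, while the new sum has its coefficients in the generic matrix algebra. *)
Lemma regular_char_poly_coef : exists2 W, gen W /\ W != 0 &
  forall A j, gen A -> gen ((regular_char_poly A)`_j *: W).
Proof.
have [y [z [gy gz cap0]]] := capelli_gen_neq0.
pose d := \det (coord_mx words); exists (capelli y z words).
  split; last first.
    by rewrite capelli_det scaler_eq0 negb_or cap0 -unitfE -unitmxE words_unit.
  apply: (big_ind gen) => [||s _]; [exact: gen0 | exact: Gen_add |].
  have gp : gen (\prod_i (y i * words (s i) * z i)).
    apply: (big_ind gen) => [||i _]; [exact: gen1 | exact: Gen_mul |].
    by do 2?apply: Gen_mul => //; apply: gen_word.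
  by rewrite -signr_odd; case: (odd s); rewrite ?expr1 ?expr0 ?scaleN1r ?scale1r //; apply: genN.
move=> A j gA.
pose x i := ('X%:M - map_mx polyC A) * map_mx polyC (words i).
have gx i : genpoly (x i).
  apply: genpolyM; last exact/genpolyC/gen_word.
  apply: genpolyD; first exact: genpolyX.
  by rewrite -map_mxN; apply/genpolyC/genN.
have := genpoly_capelli (fun i => genpolyC (gy i)) (fun i => genpolyC (gz i)) gx j.
rewrite capelli_det.
have -> : coord_mx x = map_mx polyC (coord_mx words) *m char_poly_mx (lin_mulmx A).
  apply/row_matrixP => i; rewrite row_mul -map_row !rowK /x /char_poly_mx mulmxBr mulrBl linearB.
  congr (_ - _).
    by rewrite -[_%:M * _]/(_ *m _) mul_scalar_mx linearZ /= mul_mx_scalar map_mxvec.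
  rewrite -map_mxM mul_vec_lin map_mxvec; congr mxvec; move: (words i) => w.
  by rewrite map_mxM.
have -> : capelli (fun i => map_mx polyC (y i)) (fun i => map_mx polyC (z i)) unit_family
    = map_mx polyC (capelli y z unit_family).
  rewrite (capelli_map polyC); congr capelli; apply/funext => i.
  by rewrite (unit_family_map polyC).
rewrite det_mulmx det_map_mx -/(char_poly _) -/d.
congr gen; apply/matrixP => a b; rewrite !mxE (capelli_det y z words) !mxE /= coefMC coefCM -/d.
by rewrite -mulrA mulrCA.
Qed.

Lemma det_lin_mulmx A : A \in unitmx -> \det (lin_mulmx A : 'M[Om]_N) != 0.
Proof.
move=> uA; apply/negP => /det0P [v v0 vE].
case/eqP: v0; rewrite -[v]vec_mxK.
have E : A *m vec_mx v = 0.
  by apply: (can_inj mxvecK); rewrite -(mul_vec_lin (mulmx A)) vec_mxK vE linear0.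
by rewrite -[vec_mx v](mulKmx uA) E mulmx0 linear0.
Qed.

Lemma regular_char_poly0 A : A \in unitmx -> (regular_char_poly A)`_0 != 0.
Proof.
move=> uA; rewrite /regular_char_poly.
move: (lin_mulmx A : 'M[Om]_N) (det_lin_mulmx uA) => L dL.
by rewrite char_poly_det mulf_neq0 ?signr_eq0.
Qed.

Lemma regular_Cayley_Hamilton A :
  \sum_(j < N.+1) (regular_char_poly A)`_j *: A ^+ j = 0.
Proof.
apply: (@char_poly_action Om n (n + n * n.+1) A (lin_mulmx A : 'M[Om]_N) mxvec).
  exact: can_inj mxvecK.
move=> B; have E : mxvec B *m (lin_mulmx A : 'M[Om]_N) = mxvec (A * B) := mul_vec_lin (mulmx A) B.
exact: E.
Qed.

(** The theorem of Cayley and Hamilton writes c`_0 as a combination of the elements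
    c`_j *: (W ^+ 2) ^+ j with j > 0.  One factor W absorbs the coefficient c`_j, and another
    one absorbs a coefficient e`_j of the characteristic polynomial of A.  Therefore all
    scalars e`_j * c`_0 lie in the generic matrix algebra, and the theorem of Cayley and
    Hamilton for A itself yields its inverse up to the scalar e`_0 * c`_0. *)
Lemma generic_division A : gen A -> A != 0 ->
  exists B rho, [/\ gen B, rho != 0, gen rho%:M & A * B = rho%:M].
Proof.
move=> gA A0; have [W [gW W0] coefW] := regular_char_poly_coef.
have uW := gen_unit gW W0.
have uW2 : W ^+ 2 \in unitmx by rewrite expr2 -[W * W]/(W *m W) unitmx_mul uW.
have := regular_char_poly0 uW2; have := regular_Cayley_Hamilton (W ^+ 2).
have := fun j => coefW _ j (genX 2 gW).
move: (regular_char_poly (W ^+ 2)) => c gc CHc c0.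
have := regular_char_poly0 (gen_unit gA A0); have := regular_Cayley_Hamilton A.
have := fun j => coefW _ j gA.
move: (regular_char_poly A) => e gE CHe e0.
have ge j : gen (e`_j * c`_0)%:M.
  move/eqP: CHc; rewrite big_ord_recl expr0 addr_eq0 => /eqP E.
  rewrite -scalemx1 -scalerA [X in _ *: X]E scalerN; apply: genN; rewrite scaler_sumr.
  apply: gen_sum => l _.
  have -> : e`_j *: (c`_l.+1 *: (W ^+ 2) ^+ lift ord0 l) =
     (e`_j *: W) * (c`_l.+1 *: W) * (W ^+ 2) ^+ l.
    exact: scale_square_exp.
  apply: Gen_mul; last by do 2!apply: genX.
  exact: Gen_mul (gE j) (gc l.+1).
exists (- \sum_(j < N) (e`_j.+1 * c`_0) *: A ^+ j), (e`_0 * c`_0); split.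
- apply: genN; apply: gen_sum => j _; rewrite -mul_scalar_mx; apply: Gen_mul; first exact: ge.
  exact: genX.
- exact: (mulf_neq0 e0 c0).
- exact: ge.
move/eqP: CHe; rewrite big_ord_recl expr0 addr_eq0 => /eqP E.
rewrite mulrN mulr_sumr [e`_0 * _]mulrC -scalemx1 -scalerA [X in _ *: X]E scalerN scaler_sumr.
congr (- _); apply: eq_bigr => j _.
by rewrite -scalerAr -exprS scalerA mulrC.
Qed.

End GenericDivision.

(** * Division and center in the universal division algebra *)

Lemma field_cancel (F : fieldType) (x y : F) : x != 0 -> y != 0 -> x * (y^-1 * (y / x)) = 1.
Proof. by move=> x0 y0; rewrite mulKf // mulfV. Qed.

Section UniversalDivision.

Variables (k : fieldType) (n m : nat).
Local Notation Om := (kXf k n m).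
Local Notation gen := (@generated k n m).
Local Notation F := (generic_field k n m).
Local Notation D := (UD k n m).
Local Notation j := (generic_center_frac k n m).
Local Notation pure := (tpure j).

Hypothesis gen_division : forall A, gen A -> A != 0 ->
  exists B rho, [/\ gen B, rho != 0, gen rho%:M & A * B = rho%:M].

Lemma center_frac_neq0 (s : generic_center k n m) : s != 0 -> j s != 0.
Proof. by move=> s0; rewrite /generic_center_frac /= tofrac_eq0. Qed.

Lemma UD_fraction (v : D) : exists b (s : generic_center k n m), s != 0 /\ v = pure b (j s)^-1.
Proof.
elim/tensor_ind_add: v => [|b l|x y [b [s [s0 ->]]] [b' [s' [s'0 ->]]]].
- by exists 0, 1; rewrite oner_neq0 tpure0l.
- have [r [s [s0 E]]] := fraction_numden l.
  exists (b * center_val r), s; split=> //.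
  rewrite tpure_bal; congr (pure _ _).
  by rewrite -[j r]/(FracField.tofrac r) -E mulfK // tofrac_eq0.
exists (b * center_val s' + b' * center_val s), (s * s'); split.
  exact: mulf_neq0.
have E1 : j s' / j (s * s') = (j s)^-1.
  by rewrite rmorphM /= invfM mulrCA mulfV ?center_frac_neq0 ?mulr1.
have E2 : j s / j (s * s') = (j s')^-1.
  by rewrite rmorphM /= invfM mulrA mulfV ?center_frac_neq0 ?mul1r.
by rewrite tpureDl !tpure_bal E1 E2.
Qed.

Lemma UD_mxD (x y : D) : UD_mx (x + y) = UD_mx x + UD_mx y.
Proof.
rewrite /UD_mx tliftD //.
- by move=> *; rewrite -scalerDr.
- by move=> *; rewrite rmorphD scalerDl.
move=> b' r l'; rewrite rmorphM /=.
have -> : field_scalar (j r) = center_scalar r by exact: field_scalarE.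
rewrite /= center_scalarE -[_ * _%:M]/(_ *m _) mul_mx_scalar scalerA.
by rewrite mulrC.
Qed.

Lemma UD_mx0 : UD_mx (0 : D) = 0.
Proof. by apply: (addrI (UD_mx (0 : D))); rewrite -UD_mxD !addr0. Qed.

Lemma UD_mx_sum (I : Type) (r : seq I) (P : pred I) (f : I -> D) :
  UD_mx (\sum_(i <- r | P i) f i) = \sum_(i <- r | P i) UD_mx (f i).
Proof. exact: (big_morph _ UD_mxD UD_mx0). Qed.

Lemma UD_mxM (x y : D) : UD_mx (x * y) = UD_mx x * UD_mx y.
Proof.
have [b [s [_ ->]]] := UD_fraction x; have [b' [s' [_ ->]]] := UD_fraction y.
by rewrite tpureM !UD_mx_pure rmorphM -scalerAl -scalerAr scalerA.
Qed.

Lemma UD_mx1 : UD_mx (1 : D) = 1.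
Proof. by rewrite -[1 in LHS]/(pure 1 1) UD_mx_pure rmorph1 scale1r. Qed.

Lemma UD_mxZ (a : F) (x : D) : UD_mx (a *: x) = field_scalar a *: UD_mx x.
Proof.
rewrite -[a *: x]/(pure 1 a * x) UD_mxM UD_mx_pure -scalerAl.
by rewrite -[generic_val 1]/(1 : 'M[Om]_n.+1) mul1r.
Qed.

Lemma field_scalar_eq0 (a : F) : (field_scalar a == 0) = (a == 0).
Proof. exact: fmorph_eq0. Qed.

Lemma UD_mx_eq0 (x : D) : UD_mx x = 0 -> x = 0.
Proof.
have [b [s [s0 ->]]] := UD_fraction x; rewrite UD_mx_pure => /eqP.
rewrite scaler_eq0 field_scalar_eq0 invr_eq0 (negbTE (center_frac_neq0 s0)) /= => /eqP b0.
by rewrite (_ : b = 0) ?tpure0l //; apply: val_inj.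
Qed.

(** Homogeneous identities in the universal division algebra may be scaled into the generic
    matrix algebra. *)
Lemma UD_integral_multiple (v : D) : v != 0 ->
  exists l, [/\ l != 0, gen (UD_mx (l *: v)) & UD_mx (l *: v) != 0].
Proof.
move=> v0; have [b [s [s0 E]]] := UD_fraction v; exists (j s).
have js := center_frac_neq0 s0.
have lv : j s *: v = pure b 1.
  by rewrite E -[_ *: _]/(tscale _ _) tscale_pure mulfV.
split=> //; last first.
  by apply: contraNneq v0 => /UD_mx_eq0/eqP; rewrite scaler_eq0 (negbTE js).
by rewrite lv UD_mx_pure rmorph1 scale1r; apply: generic_valP.
Qed.

Lemma UD_division (v : D) : v != 0 -> exists w, v * w = 1.
Proof.
move=> v0; have [b [s [s0 E]]] := UD_fraction v.
have js := center_frac_neq0 s0.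
have b0 : generic_val b != 0.
  apply: contraNneq v0 => b0; rewrite E (_ : b = 0) ?tpure0l //; exact: val_inj.
have [B [rho [gB rho0 grho BE]]] := gen_division (generic_valP b) b0.
pose b' : generic_alg k n m := GenericAlg (introT (genericP _) gB).
pose c : generic_alg k n m := GenericAlg (introT (genericP _) grho).
have cc : c \in @central (generic_alg k n m).
  by apply/centralP => y; apply: val_inj; apply: esym; apply: scalar_mxC.
pose r : generic_center k n m := RingCenter cc.
have r0 : r != 0.
  apply: contraNneq rho0 => r0.
  have : generic_val (center_val r) = 0 by rewrite r0.
  by move=> /matrixP/(_ 0 0); rewrite /= !mxE eqxx mulr1n => ->.
have bb : b * b' = 1 * center_val r by rewrite mul1r; apply: val_inj; exact: BE.
have jr := center_frac_neq0 r0.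
have E1 : j r * ((j s)^-1 * (j s / j r)) = 1.
  exact: (field_cancel jr js).
exists (pure b' (j s / j r)); rewrite E tpureM bb tpure_bal.
rewrite -[RHS]/(pure 1 1).
exact: (congr1 (pure 1) E1).
Qed.

Lemma UD_center (v : D) : (forall w, v * w = w * v) -> exists a : F, v = a *: 1.
Proof.
move=> cv; have [b [s [s0 E]]] := UD_fraction v.
have js := center_frac_neq0 s0.
have cb : b \in @central (generic_alg k n m).
  apply/centralP => c; apply: val_inj; have := congr1 (@UD_mx k n m) (cv (pure c 1)).
  rewrite E !UD_mxM !UD_mx_pure rmorph1 scale1r -scalerAl -scalerAr.
  by apply: scalerI; rewrite field_scalar_eq0 invr_eq0.
pose r : generic_center k n m := RingCenter cb.
exists (j r * (j s)^-1); rewrite E -[1]/(pure 1 1) -[_ *: _]/(tscale _ _) tscale_pure mulr1.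
by rewrite -tpure_bal mul1r.
Qed.

End UniversalDivision.

(** * Maximal subfields that are Galois *)

Section GaloisMaximal.

Variables (F : fieldType) (D : algType F) (K : splittingFieldType F).
Variable f : {lrmorphism K -> D}.
Hypothesis K_galois : galois 1 {:K}.
Hypothesis K_max : is_maximal_subfield (fun x : D => exists a, f a = x).
Hypothesis D_div : forall v : D, v != 0 -> exists w, v * w = 1.
Hypothesis D_center : forall v : D, (forall w, v * w = w * v) -> exists a : F, v = a *: 1.

Local Notation G := ('Gal({:K} / 1))%g.
Local Notation d := #|G|.

Definition intertwines (u : D) (s : gal_of {:K}) : Prop := forall x, u * f x = f (s x) * u.

Lemma division_inverse (v : D) : v != 0 -> exists2 w, v * w = 1 & w * v = 1.
Proof.
move=> v0; have [w vw] := D_div v0; exists w => //.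
have w0 : w != 0 by apply: contraTneq (oner_neq0 D) => w0; rewrite -vw w0 mulr0 eqxx.
have [t wt] := D_div w0.
suff -> : v = t by [].
by rewrite -[t]mul1r -vw -mulrA wt mulr1.
Qed.

Lemma division_mulf_neq0 (u v : D) : u != 0 -> v != 0 -> u * v != 0.
Proof.
move=> /division_inverse [w _ wu]; apply: contra_neq => uv.
by rewrite -[v]mul1r -wu -mulrA uv mulr0.
Qed.

(** If z commutes with K, then the double centralizer of K and z is commutative and closed
    under inverses, so that it is a subfield containing K. *)
Lemma maximal_subfield_centralizer (z : D) : (forall x, z * f x = f x * z) -> exists a, f a = z.
Proof.
move=> zf; pose C (y : D) := y * z = z * y /\ forall x, y * f x = f x * y.
pose T (x : D) := forall y, C y -> x * y = y * x.
have Cz : C z by split.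
have Cf a : C (f a).
  by split=> [|x]; rewrite ?zf // -!rmorphM mulrC.
have TC x : T x -> C x.
  by move=> Tx; split=> [|a]; [apply: Tx | apply: Tx].
case: K_max => _ max; apply: (max T) => [||y [yz _]] //.
  split.
  - by move=> y _; rewrite mul1r mulr1.
  - by move=> x y Tx Ty t Ct; rewrite mulrBl mulrBr Tx // Ty.
  - by move=> x y Tx Ty t Ct; rewrite -mulrA Ty // mulrA Tx // mulrA.
  - by move=> x y Tx Ty; apply: Tx; apply: TC.
  move=> x Tx /division_inverse [w xw wx]; exists w => // y Cy.
  rewrite -[RHS]mul1r -wx -!mulrA; congr (_ * _).
  by rewrite [x * _]mulrA Tx // -mulrA xw mulr1.
by move=> _ [a <-] y [_ yf]; rewrite yf.
Qed.

Let sg (i : 'I_d) : gal_of {:K} := enum_val i.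

Lemma sg_gal i : sg i \in G. Proof. exact: enum_valP. Qed.

Lemma dim_galois : \dim {:K} = d.
Proof. by have := galois_dim K_galois; rewrite dimv1 divn1. Qed.

Variables (w : 'I_d -> K) (C : 'M[K]_d).
Hypothesis wC : forall i i', \sum_l sg i (w l) * C l i' = (i == i')%:R.
Hypothesis Cw : forall l l', \sum_i C l i * sg i (w l') = (l == l')%:R.

Lemma dual_basis_span (x : K) : exists a : 'I_d -> F, x = \sum_l a l *: w l.
Proof.
pose X := [tuple w l | l < d].
have XE (l : 'I_d) : X`_l = w l by rewrite -tnth_nth tnth_mktuple.
have freeX : free X.
  apply/freeP => a a0 l.
  have E i : \sum_j sg i (w j) * (a j)%:A = 0.
    have := congr1 (sg i) a0; rewrite rmorph0 rmorph_sum => E; apply: etrans E.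
    by apply: eq_bigr => j _; rewrite /= XE linearZ /= mulr_algr.
  have : \sum_i C l i * \sum_j sg i (w j) * (a j)%:A = (a l)%:A.
    transitivity (\sum_j (\sum_i C l i * sg i (w j)) * (a j)%:A).
      under eq_bigr => i _ do rewrite mulr_sumr.
      rewrite exchange_big; apply: eq_bigr => j _ /=.
      by rewrite mulr_suml; apply: eq_bigr => i _; rewrite mulrA.
    rewrite (bigD1 l) //= Cw eqxx mul1r big1 ?addr0 // => j jl.
    by rewrite Cw eq_sym (negbTE jl) mul0r.
  rewrite big1 => [/esym/eqP|i _]; last by rewrite E mulr0.
  by rewrite scaler_eq0 oner_eq0 orbF => /eqP.
have bX : basis_of {:K} X.
  by rewrite basisEfree freeX subvf size_tuple dim_galois leqnn.
exists (fun l => coord X l x); rewrite {1}(coord_basis bX (memvf x)).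
by apply: eq_bigr => l _; rewrite XE.
Qed.

(** The algebra K (x) K is a product of copies of K, one for each automorphism, and it acts on
    D by multiplications on both sides; this is the action of the idempotent of sg i. *)
Definition isotypic (i : 'I_d) (v : D) : D := \sum_l f (C l i) * v * f (w l).

(** The idempotent satisfies the same relation in K (x) K, where it can be checked by applying
    every automorphism to the right factor. *)
Lemma isotypic_intertwines i v : intertwines (isotypic i v) (sg i).
Proof.
move=> x; have /choice [a Ha] l := dual_basis_span (w l * x).
have key j : \sum_l a l j *: C l i = sg i x * C j i.
  have E i' : \sum_j (\sum_l a l j *: C l i - sg i x * C j i) * sg i' (w j) = 0.
    have -> : \sum_j (\sum_l a l j *: C l i - sg i x * C j i) * sg i' (w j) =
       \sum_l C l i * sg i' (w l * x) - sg i x * \sum_j sg i' (w j) * C j i.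
      rewrite mulr_sumr -sumrB.
      under eq_bigr => j' _ do rewrite mulrBl mulr_suml.
      rewrite !sumrB exchange_big /=; congr (_ - _).
        apply: eq_bigr => l _; rewrite Ha linear_sum mulr_sumr; apply: eq_bigr => j' _.
        by rewrite linearZ -scalerAl -scalerAr.
      by apply: eq_bigr => j' _; rewrite -mulrA [C _ _ * _]mulrC.
    under eq_bigr => l _ do rewrite rmorphM mulrCA mulrA.
    rewrite -mulr_suml wC; case: eqP => [->|_]; rewrite ?(mulr0, mul0r) ?subrr //.
    by rewrite mul1r mulr1 subrr.
  apply/eqP; rewrite -subr_eq0; apply/eqP.
  transitivity (\sum_j' (\sum_l a l j' *: C l i - sg i x * C j' i) * (j == j')%:R).
    rewrite [RHS](bigD1 j) //= eqxx mulr1 [X in _ = _ + X]big1 ?addr0 // => j' jj.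
    by rewrite eq_sym (negbTE jj) mulr0.
  under eq_bigr => j' _ do rewrite -Cw mulr_sumr.
  rewrite exchange_big big1 // => i' _ /=.
  under eq_bigr => j' _ do rewrite mulrCA.
  by rewrite -mulr_sumr E mulr0.
rewrite /isotypic mulr_suml mulr_sumr.
transitivity (\sum_j f (\sum_l a l j *: C l i) * v * f (w j)).
  under eq_bigr => l _ do rewrite -mulrA -rmorphM Ha rmorph_sum mulr_sumr.
  rewrite exchange_big; apply: eq_bigr => j _ /=.
  rewrite rmorph_sum !mulr_suml; apply: eq_bigr => l _.
  by rewrite /= !linearZ /= -!scalerAl -!scalerAr.
by apply: eq_bigr => j _; rewrite key rmorphM !mulrA.
Qed.

Lemma isotypic_sum v : \sum_i isotypic i v = v.
Proof.
have [a E1] := dual_basis_span 1.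
have key l : \sum_i C l i = a l *: 1.
  transitivity (\sum_i \sum_l' a l' *: (C l i * sg i (w l'))).
    apply: eq_bigr => i _.
    have E2 : 1 = \sum_l' a l' *: sg i (w l').
      have := congr1 (sg i) E1; rewrite rmorph1 linear_sum => E; apply: (etrans E).
      by apply: eq_bigr => l' _; rewrite linearZ.
    apply: (etrans (esym (mulr1 _))); apply: (etrans (congr1 (fun y => C l i * y) E2)).
    by rewrite mulr_sumr; apply: eq_bigr => l' _; rewrite scalerAr.
  rewrite exchange_big; transitivity (\sum_l' a l' *: ((l == l')%:R : K)).
    by apply: eq_bigr => l' _; rewrite -Cw scaler_sumr.
  rewrite (bigD1 l) //= eqxx big1 ?addr0 // => l' ll.
  by rewrite eq_sym (negbTE ll) scaler0.
have fA c : f (c *: 1) = c *: 1 by rewrite linearZ rmorph1.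
transitivity (\sum_l v * f (a l *: w l)); last first.
  by rewrite -mulr_sumr -linear_sum -E1 rmorph1 mulr1.
rewrite exchange_big; apply: eq_bigr => l _ /=.
rewrite -!mulr_suml -rmorph_sum key /= fA linearZ /=.
by rewrite -!scalerAl mul1r scalerAr.
Qed.

Lemma isotypic_id i i' u k : intertwines u (sg i) ->
  isotypic i' (f k * u) = (i == i')%:R *: (f k * u).
Proof.
move=> iu; rewrite /isotypic.
transitivity (f (\sum_l sg i (w l) * C l i') * (f k * u)).
  rewrite rmorph_sum mulr_suml; apply: eq_bigr => l _.
  by rewrite -!mulrA iu !mulrA -!rmorphM; congr (f _ * _); rewrite mulrC mulrA.
by rewrite wC rmorph_nat; case: (i == i'); rewrite ?mul1r ?mul0r ?scale1r ?scale0r.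
Qed.

(** The automorphisms s that have an intertwiner form a group H.  An element of K fixed by H
    commutes with all isotypic components, so it is central; hence H is the whole group. *)
Lemma exists_intertwiner s : s \in G -> exists2 u, u != 0 & intertwines u s.
Proof.
pose H := [set s in G | `[< exists2 u, u != 0 & intertwines u s >]].
suff HG : H = G by rewrite -{1}HG inE => /andP[_ /asboolP].
have gH : group_set H.
  apply/group_setP; split.
    rewrite inE group1; apply/asboolP; exists 1; first exact: oner_neq0.
    by move=> x; rewrite gal_id mul1r mulr1.
  move=> s1 s2; rewrite !inE => /andP[G1 /asboolP[u1 u10 i1]] /andP[G2 /asboolP[u2 u20 i2]].
  rewrite groupM //; apply/asboolP; exists (u2 * u1); first exact: division_mulf_neq0.
  by move=> x; rewrite -mulrA i1 mulrA i2 galM ?memvf // mulrA.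
pose Hg := Group gH.
have fix1 : fixedField Hg = 1%VS :> {vspace K}.
  apply/eqP; rewrite eqEsubv; apply/andP; split; last first.
    by apply/subvP => x; exact: (subvP (sub1v (fixedField Hg))).
  apply/subvP => x /mem_fixedFieldP[_ fx].
  have [v|a fa] := D_center (v := f x).
    rewrite -[v]isotypic_sum mulr_sumr mulr_suml; apply: eq_bigr => i _.
    have [->|nz] := eqVneq (isotypic i v) 0; first by rewrite mulr0 mul0r.
    rewrite (isotypic_intertwines i v x) fx // inE sg_gal; apply/asboolP.
    by exists (isotypic i v) => //; apply: isotypic_intertwines.
  have -> : x = a *: 1 by apply: (fmorph_inj f); rewrite /= fa linearZ /= rmorph1.
  by rewrite memvZ // memv_line.
have := gal_fixedField Hg.
by rewrite fix1 => ->.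
Qed.

Section Degree.

Variables (Om : fieldType) (n : nat) (phi : {rmorphism F -> Om}) (psi : D -> 'M[Om]_n.+1).
Hypothesis psiD : forall x y, psi (x + y) = psi x + psi y.
Hypothesis psiM : forall x y, psi (x * y) = psi x * psi y.
Hypothesis psi1 : psi 1 = 1.
Hypothesis psiZ : forall a x, psi (a *: x) = phi a *: psi x.
Hypothesis psi_span : forall A, exists (T : finType) (c : T -> Om) (b : T -> D),
  A = \sum_t c t *: psi (b t).

Let psi0 : psi 0 = 0.
Proof. by apply: (addrI (psi 0)); rewrite -psiD !addr0. Qed.

Let psi_sum (I : Type) (r : seq I) (P : pred I) (h : I -> D) :
  psi (\sum_(i <- r | P i) h i) = \sum_(i <- r | P i) psi (h i).
Proof. exact: (big_morph _ psiD psi0). Qed.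

Variable u : 'I_d -> D.
Hypothesis u0 : forall i, u i != 0.
Hypothesis uI : forall i, intertwines (u i) (sg i).

(** Two intertwiners of the same automorphism differ by an element that commutes with K. *)
Lemma isotypic_mul i v : intertwines v (sg i) -> exists k, v = f k * u i.
Proof.
move=> vI; have [u' uu' u'u] := division_inverse (u0 i).
have [x|k fk] := maximal_subfield_centralizer (z := v * u').
  have -> : x = sg i ((sg i)^-1%g x).
    by rewrite -galM ?memvf // mulVg gal_id.
  set y := (sg i)^-1%g x.
  have E : u' * f (sg i y) = f y * u'.
    by rewrite -[RHS]mul1r -u'u -mulrA (mulrA (u i)) uI -!mulrA uu' mulr1.
  by rewrite -mulrA E mulrA vI mulrA.
by exists k; rewrite fk -mulrA u'u mulr1.
Qed.

Definition galois_comb (kap : 'M[Om]_d) : 'M[Om]_n.+1 :=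
  \sum_i \sum_l kap i l *: psi (f (w l) * u i).

Lemma galois_comb_linear : linear galois_comb.
Proof.
move=> a x y; rewrite /galois_comb scaler_sumr -big_split; apply: eq_bigr => i _.
rewrite scaler_sumr -big_split; apply: eq_bigr => l _ /=.
by rewrite !mxE scalerDl scalerA.
Qed.

HB.instance Definition _ := GRing.isLinear.Build Om 'M[Om]_d 'M[Om]_n.+1 _ galois_comb
  galois_comb_linear.

(** The isotypic projections separate the rows of kap.  Conjugation by the u i turns the
    relation left in each row into its Galois conjugates, and the dual basis inverts those. *)
Lemma galois_comb_inj kap : galois_comb kap = 0 -> kap = 0.
Proof.
move=> k0.
have E1 i' : \sum_l kap i' l *: psi (f (w l)) = 0.
  have : \sum_l' psi (f (C l' i')) * galois_comb kap * psi (f (w l')) = 0.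
    by rewrite big1 // => l _; rewrite k0 mulr0 mul0r.
  have -> : \sum_l' psi (f (C l' i')) * galois_comb kap * psi (f (w l')) =
      \sum_i \sum_l kap i l *: psi (isotypic i' (f (w l) * u i)).
    rewrite /galois_comb.
    under eq_bigr => l' _ do rewrite mulr_sumr mulr_suml.
    rewrite exchange_big; apply: eq_bigr => i _ /=.
    under eq_bigr => l' _ do rewrite mulr_sumr mulr_suml.
    rewrite exchange_big; apply: eq_bigr => l _ /=.
    rewrite psi_sum scaler_sumr; apply: eq_bigr => l' _.
    by rewrite !psiM -scalerAr -scalerAl.
  rewrite (bigD1 i') //= [X in _ + X]big1 => [|i ii]; last first.
    by apply: big1 => l _; rewrite (isotypic_id _ _ (uI i)) (negbTE ii) scale0r psi0 scaler0.
  rewrite addr0.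
  under eq_bigr => l _ do rewrite (isotypic_id _ _ (uI i')) eqxx scale1r psiM scalerAl.
  rewrite -mulr_suml => E; have [u' uu' _] := division_inverse (u0 i').
  by rewrite -[LHS]mulr1 -psi1 -uu' psiM mulrA E mul0r.
have E2 i' i : \sum_l kap i' l *: psi (f (sg i (w l))) = 0.
  have [u' uu' u'u] := division_inverse (u0 i).
  transitivity (psi (u i) * (\sum_l kap i' l *: psi (f (w l))) * psi u').
    2: by rewrite E1 mulr0 mul0r.
  rewrite mulr_sumr mulr_suml; apply: eq_bigr => l _.
  by rewrite -scalerAr -scalerAl -!psiM uI -mulrA uu' mulr1.
apply/matrixP => i' l'; rewrite [RHS]mxE.
have : \sum_i psi (f (C l' i)) * \sum_l kap i' l *: psi (f (sg i (w l))) = 0.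
  by apply: big1 => i _; rewrite E2 mulr0.
have -> : \sum_i psi (f (C l' i)) * \sum_l kap i' l *: psi (f (sg i (w l))) =
   \sum_l kap i' l *: psi (f (\sum_i C l' i * sg i (w l))).
  under eq_bigr => i _ do rewrite mulr_sumr.
  rewrite exchange_big; apply: eq_bigr => l _ /=.
  rewrite rmorph_sum psi_sum scaler_sumr; apply: eq_bigr => i _.
  by rewrite rmorphM psiM scalerAr.
rewrite (bigD1 l') //= Cw eqxx rmorph1 psi1 big1 => [|l ll].
  by rewrite addr0 => /matrixP/(_ 0 0); rewrite !mxE eqxx mulr1.
by rewrite Cw eq_sym (negbTE ll) rmorph0 psi0 scaler0.
Qed.

Lemma galois_comb_surj A : exists kap, galois_comb kap = A.
Proof.
have [T [c [b ->]]] := psi_span A.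
have /choice [k Hk] (p : T * 'I_d) : exists k, isotypic p.2 (b p.1) = f k * u p.2.
  exact/isotypic_mul/isotypic_intertwines.
have /choice [a Ha] (p : T * 'I_d) := dual_basis_span (k p).
exists (\matrix_(i, l) \sum_t c t * phi (a (t, i) l)).
have bE t : psi (b t) = \sum_i \sum_l phi (a (t, i) l) *: psi (f (w l) * u i).
  rewrite -[in LHS](isotypic_sum (b t)) psi_sum; apply: eq_bigr => i _.
  rewrite (Hk (t, i)) (Ha (t, i)) linear_sum mulr_suml psi_sum; apply: eq_bigr => l _.
  by rewrite linearZ /= -scalerAl psiZ.
under [RHS]eq_bigr => t _ do rewrite bE scaler_sumr.
rewrite exchange_big /galois_comb; apply: eq_bigr => i _ /=.
under [RHS]eq_bigr => t _ do rewrite scaler_sumr.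
rewrite exchange_big; apply: eq_bigr => l _ /=.
by rewrite mxE scaler_suml; apply: eq_bigr => t _; rewrite scalerA.
Qed.

(** Through galois_comb, the matrices of size d and those of size n.+1 over Om are isomorphic
    vector spaces. *)
Lemma galois_degree : d = n.+1.
Proof.
pose T := lin_mx galois_comb.
have fr : row_free T.
  apply: inj_row_free => v; rewrite -[v]vec_mxK mul_vec_lin /= => /(canRL mxvecK).
  by rewrite linear0 => /galois_comb_inj ->; rewrite linear0.
have fu : row_full T.
  have /choice [B HB] i := galois_comb_surj (vec_mx (row i 1%:M)).
  apply/row_fullP; exists (\matrix_i mxvec (B i)).
  by apply/row_matrixP => i; rewrite row_mul rowK mul_vec_lin /= HB vec_mxK.
move: fr fu; rewrite /row_free /row_full => /eqP-> /eqP; rewrite !mulnn => /eqP.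
by rewrite eqn_sqr => /eqP.
Qed.

End Degree.

End GaloisMaximal.

(** By the independence of automorphisms, some family w has an invertible matrix of
    conjugates. *)
Lemma galois_dual_basis (F : fieldType) (K : splittingFieldType F) :
  exists (w : 'I_#|('Gal({:K} / 1))%g| -> K) (C : 'M[K]_#|('Gal({:K} / 1))%g|),
    (forall i i', \sum_l (enum_val i : gal_of {:K}) (w l) * C l i' = (i == i')%:R) /\
    (forall l l', \sum_i C l i * (enum_val i : gal_of {:K}) (w l') = (l == l')%:R).
Proof.
have [w _ [uM _ _]] := gal_matrix ('Gal({:K} / 1))%g.
set M := \matrix_(i, j) _ in uM.
exists (tnth w), (invmx M); split=> i i'.
  have /matrixP/(_ i i') := mulmxV uM; rewrite !mxE => <-.
  by apply: eq_bigr => l _; rewrite mxE.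
have /matrixP/(_ i i') := mulVmx uM; rewrite !mxE => <-.
by apply: eq_bigr => l _; rewrite mxE.
Qed.

(** * Tori of small exponent *)

Lemma torus_data_dvd (K : fieldType) (a N M t : nat) (g : 'I_t -> 'M[K]_a) :
  (N %| M)%N -> torus_data N g -> torus_data M g.
Proof.
move=> /dvdnP[q ->] [ug cg gg]; split=> // i j.
by have [c cN E] := cg i j; exists c; rewrite // mulnC exprM cN expr1n.
Qed.

(** A tensor product of r pairs of size p and one of size q: its commutation factors have orders
    dividing p * q, however large r is. *)
Lemma torus_data_elementary (K : fieldType) (p q r : nat) (x y : K) :
  p.-primitive_root x -> q.-primitive_root y ->
  exists (t : nat) (g : 'I_t -> 'M[K]_(p ^ r * q)), torus_data (p * q) g.
Proof.
move=> xp yq; have p0 := prim_order_gt0 xp; have q0 := prim_order_gt0 yq.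
case: p xp p0 => // p xp _; case: q yq q0 => // q yq _.
elim: r => [|r [t [g Hg]]].
  rewrite expn0 mul1n; exists 2, (clock_shift q y).
  exact: torus_data_dvd (dvdn_mull _ (dvdnn _)) (torus_data_clock_shift yq).
rewrite expnS -mulnA; exists (2 + t)%N, (tensor_family (clock_shift p x) g).
apply: torus_data_tensor => //.
exact: torus_data_dvd (dvdn_mulr _ (dvdnn _)) (torus_data_clock_shift xp).
Qed.

(** * Conjugations that induce Galois automorphisms *)

Section Intertwiners.

Variables (F : fieldType) (D : algType F) (K : splittingFieldType F).
Variable f : {lrmorphism K -> D}.
Implicit Types (u v : D) (s : gal_of {:K}).

Lemma intertwines1 : intertwines f 1 1%g.
Proof. by move=> x; rewrite gal_id mul1r mulr1. Qed.

Lemma intertwinesM u v s s' : intertwines f u s -> intertwines f v s' ->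
  intertwines f (u * v) (s' * s)%g.
Proof. by move=> us vs x; rewrite galM ?memvf // -mulrA vs !mulrA us. Qed.

Lemma intertwinesX u s d : intertwines f u s -> intertwines f (u ^+ d) (s ^+ d)%g.
Proof.
move=> us; elim: d => [|d IH]; first by rewrite expr0 expg0; apply: intertwines1.
by rewrite exprS expgSr; apply: intertwinesM.
Qed.

Lemma intertwinesZ u s (a : F) : intertwines f u s -> intertwines f (a *: u) s.
Proof. by move=> us x; rewrite -scalerAl us scalerAr. Qed.

(** Moving f (s x - x) to the left past the powers of u yields a telescoping sum, since
    u ^+ i induces s ^+ i. *)
Lemma intertwines_conj_sum u s d (x : K) : intertwines f u s -> (s ^+ d)%g = 1%g ->
  \sum_(i < d) u ^+ i * f (s x - x) * u ^+ (d.-1 - i) = 0.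
Proof.
case: d => [|d] us sd; first by rewrite big_ord0.
transitivity (f (\sum_(0 <= i < d.+1) ((s ^+ i.+1)%g x - (s ^+ i)%g x)) * u ^+ d).
  rewrite big_mkord rmorph_sum mulr_suml; apply: eq_bigr => i _.
  have id : (i <= d)%N by rewrite -ltnS.
  rewrite (intertwinesX i us) -mulrA -exprD /= (subnKC id).
  congr (_ * _); congr (f _).
  rewrite rmorphB /= -galM; last exact: memvf.
  by rewrite -expgS.
transitivity (f 0 * u ^+ d); last by rewrite rmorph0 mul0r.
congr (f _ * _); apply: (etrans (telescope_sumr (fun i => (s ^+ i)%g x) (leq0n d.+1))).
by rewrite sd expg0 subrr.
Qed.

Lemma gal_moves s : s != 1%g -> exists x : K, s x - x != 0.
Proof.
move=> s1; have [//|nex] := pselect (exists x : K, s x - x != 0).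
case/negP: s1; apply/gal_eqP => x _; rewrite gal_id.
apply/eqP; rewrite -subr_eq0; apply/negPn/negP => sx.
by apply: nex; exists x.
Qed.

End Intertwiners.

(** * Galois groups in the universal division algebra *)

Section NotCrossed.

Variables (k : fieldType) (n m : nat).
Hypothesis k_inf : infinite_set [set: k]%classic.
Hypothesis n_char : forall q : nat, q \in [pchar k] -> ~~ (q %| n.+1)%N.

Local Notation gen := (@generated k n m).
Local Notation F := (generic_field k n m).
Local Notation D := (UD k n m).

Variables (L : fieldType) (iota : {rmorphism k -> L}) (z : L).
Hypothesis z_prim : n.+1.-primitive_root z.

Lemma dvd_degree_neq0 d : (d %| n.+1)%N -> d%:R != 0 :> k.
Proof.
move=> dn; apply/negP => d0; have d_gt0 : (0 < d)%N by apply: dvdn_gt0 dn.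
have [q qk] := natf0_pchar d_gt0 d0.
have := n_char qk; rewrite (dvdn_trans _ dn) //.
by rewrite (dvdn_pcharf qk).
Qed.

Lemma UD_gen_division A : gen A -> A != 0 ->
  exists B rho, [/\ gen B, rho != 0, gen rho%:M & A * B = rho%:M].
Proof.
apply: generic_division => B.
exact: (generated_unit iota k_inf (ltn0Sn n) (torus_data_clock_shift z_prim)).
Qed.

Lemma UD_mxX (x : D) d : UD_mx (x ^+ d) = UD_mx x ^+ d.
Proof. by elim: d => [|d IH]; rewrite ?expr0 ?UD_mx1 // !exprS UD_mxM IH. Qed.

Lemma UD_mx_span A : exists (T : finType) (c : T -> kXf k n m) (b : T -> D),
  A = \sum_t c t *: UD_mx (b t).
Proof.
have [c ->] := @word_span k n m A.
exists _, c, (fun t => tpure (generic_center_frac k n m)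
  (GenericAlg (introT (genericP _) (@gen_word k n m t))) 1).
by apply: eq_bigr => t _; rewrite UD_mx_pure rmorph1 scale1r.
Qed.

Variables (K : splittingFieldType F) (f : {lrmorphism K -> D}).
Hypothesis K_galois : galois 1 {:K}.
Hypothesis K_max : is_maximal_subfield (fun x : D => exists a, f a = x).

Lemma UD_intertwiner s : s \in ('Gal({:K} / 1))%g -> exists2 u : D, u != 0 & intertwines f u s.
Proof.
have [w [C [wC Cw]]] := galois_dual_basis K.
exact: (exists_intertwiner f K_galois (UD_division UD_gen_division) (@UD_center k n m) wC Cw).
Qed.

Lemma UD_galois_degree : #|('Gal({:K} / 1))%g| = n.+1.
Proof.
have [w [C [wC Cw]]] := galois_dual_basis K.
have /choice [u Hu] (i : 'I_#|('Gal({:K} / 1))%g|) :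
    exists u : D, u != 0 /\ intertwines f u (enum_val i).
  by have [u ? ?] := UD_intertwiner (enum_valP i); exists u.
have E := galois_degree K_galois K_max (UD_division UD_gen_division) wC Cw
  (phi := @field_scalar k n m)
  (@UD_mxD k n m) (@UD_mxM k n m) (@UD_mx1 k n m) (@UD_mxZ k n m) UD_mx_span
  (fun i => proj1 (Hu i)) (fun i => proj2 (Hu i)).
exact: E.
Qed.

Lemma UD_integral_intertwiner s : s \in ('Gal({:K} / 1))%g ->
  exists u : D, [/\ gen (UD_mx u), UD_mx u != 0 & intertwines f u s].
Proof.
move=> /UD_intertwiner [u u0 us]; have [l [l0 gu nu]] := UD_integral_multiple u0.
by exists (l *: u); split=> //; apply: intertwinesZ.
Qed.

Lemma UD_integral_difference (s : gal_of {:K}) : s != 1%g ->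
  exists x : K, gen (UD_mx (f (s x - x))) /\ UD_mx (f (s x - x)) != 0.
Proof.
move=> /gal_moves [x x0]; have fx0 : f (s x - x) != 0 by rewrite fmorph_eq0.
have [l [l0 gu nu]] := UD_integral_multiple fx0.
have E : f (s (l *: x) - l *: x) = l *: f (s x - x).
  by rewrite -linearZ scalerBr linearZ.
by exists (l *: x); rewrite E.
Qed.

Lemma UD_mx_conj_sum (u y : D) d :
  \sum_(i < d) u ^+ i * y * u ^+ (d.-1 - i) = 0 ->
  \sum_(i < d) UD_mx u ^+ i * UD_mx y * UD_mx u ^+ (d.-1 - i) = 0.
Proof.
move=> /(congr1 (@UD_mx k n m)); rewrite UD_mx0 UD_mx_sum; apply: etrans.
by apply: eq_bigr => i _; rewrite !UD_mxM !UD_mxX.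
Qed.

(** If s ^+ N moves x, then the conjugation sum for s ^+ N and x vanishes.  Its length is the
    order of s ^+ N, which divides the degree and so is invertible in k. *)
Lemma UD_galois_exponent (N t : nat) (g : 'I_t -> 'M[L]_n.+1) s : (0 < N)%N ->
  torus_data N g -> s \in ('Gal({:K} / 1))%g -> (s ^+ N)%g = 1%g.
Proof.
move=> N0 gT sG; apply/eqP; apply: contrapT => /negP tau1.
have [u [gu u0 us]] := UD_integral_intertwiner sG.
have [x [gy y0]] := UD_integral_difference tau1.
have sum0 := intertwines_conj_sum x (intertwinesX N us) (expg_order (s ^+ N)%g).
have := UD_mx_conj_sum sum0; rewrite UD_mxX.
move/(generated_exponent iota k_inf N0 gT gu gy u0 y0)/eqP; apply/negP/dvd_degree_neq0.
by rewrite -UD_galois_degree; apply: order_dvdG; rewrite groupX.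
Qed.

(** The element u i ^+ p.-1 * u i' induces rho i i', which is nontrivial for i != i' and has
    order p. *)
Lemma UD_galois_rank (p : nat) (P : {group gal_of {:K}}) :
  prime p -> (p %| n.+1)%N -> P \subset ('Gal({:K} / 1))%g ->
  (forall s, s \in P -> (s ^+ p)%g = 1%g) -> (#|P| <= p ^ 2)%N.
Proof.
move=> p_pr pn PG Pp; rewrite leqNgt; apply/negP => Pgt.
have p0 := prime_gt0 p_pr.
have /choice [u Hu] (i : 'I_#|P|) : exists u : D,
    [/\ gen (UD_mx u), UD_mx u != 0 & intertwines f u (enum_val i)].
  by apply: UD_integral_intertwiner; exact: (fintype.subsetP PG _ (enum_valP i)).
have /choice [y Hy] (s : gal_of {:K}) : exists y : K,
    [/\ gen (UD_mx (f y)), UD_mx (f y) != 0 & s != 1%g -> exists x, y = s x - x].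
  have [->|/UD_integral_difference [x [gx x0]]] := eqVneq s 1%g; last first.
    by exists (s x - x); split=> // _; exists x.
  by exists 1; rewrite rmorph1 UD_mx1; split; [exact: gen1 | exact: oner_neq0 |].
have Pi (i : 'I_#|P|) : enum_val i \in P := enum_valP i.
pose rho (i i' : 'I_#|P|) : gal_of {:K} := (enum_val i' * enum_val i ^+ p.-1)%g.
have := @generated_rank2 k n m L iota z k_inf z_prim p _ _ rho
  (fun i => UD_mx (u i)) (fun s => UD_mx (f (y s))) p0.
rewrite card_ord => /(_ Pgt) H.
have /eqP : p%:R = 0 :> k; last by apply/negP/dvd_degree_neq0.
apply: H => [i|s|i s|i i' ii' w].
- by have [] := Hu i.
- by have [] := Hy s.
- rewrite -UD_mxX -!UD_mxM; congr UD_mx; have [_ _ ui] := Hu i.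
  by rewrite (intertwinesX p ui) Pp // gal_id.
rewrite /w -UD_mxX -UD_mxM; apply: UD_mx_conj_sum.
have rP : rho i i' \in P by rewrite groupM // groupX.
have [_ _ [|x ->]] := Hy (rho i i').
  apply: contra ii' => /eqP r1; apply/eqP/enum_val_inj.
  have := congr1 (fun s => s * enum_val i)%g r1.
  by rewrite /rho mul1g -mulgA -expgSr prednK // Pp // mulg1.
have [_ _ ui] := Hu i; have [_ _ ui'] := Hu i'.
apply: intertwines_conj_sum; last exact: Pp.
exact: intertwinesM (intertwinesX _ ui) ui'.
Qed.

End NotCrossed.

(** * The universal division algebra is a noncrossed product *)

Theorem theorem4 (k : fieldType) (n m p : nat) :
  infinite_set [set: k]%classic ->
  (forall q : nat, q \in [pchar k] -> ~~ (q %| n.+1)%N) ->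
  prime p -> (p ^ 3 %| n.+1)%N ->
  ~ crossed_product (UD k n m).
Proof.
move=> k_inf n_char p_pr p3n [K [f [K_galois K_max]]].
have n0 : n.+1%:R != 0 :> k := dvd_degree_neq0 n_char (dvdnn n.+1).
have [L [iota [z z_prim]]] := exists_primitive_root_extension (ltn0Sn n) n0.
have dG := UD_galois_degree k_inf iota z_prim K_galois K_max.
pose G := ('Gal({:K} / 1))%G.
have [P PG] := Sylow_exists p G.
have cP : #|P| = (p ^ logn p n.+1)%N by rewrite (card_Hall PG) dG p_part.
have r3 : (3 <= logn p n.+1)%N by rewrite -pfactor_dvdn.
pose q := partn n.+1 p^'.
have nE : (p ^ logn p n.+1 * q)%N = n.+1 by rewrite -p_part partnC.
have pn : (p %| n.+1)%N by rewrite (dvdn_trans _ p3n) // dvdn_exp.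
have qn : (q %| n.+1)%N by rewrite -nE dvdn_mull.
have [t [g gT]] := torus_data_elementary (logn p n.+1)
  (dvdn_prim_root z_prim pn) (dvdn_prim_root z_prim qn).
rewrite nE in g gT.
(* q = n.+1`_p^' is prime to the orders of the elements of P *)
have Pp s : s \in P -> (s ^+ p)%g = 1%g.
  move=> sP; have sG := fintype.subsetP (pHall_sub PG) s sP.
  have pq0 : (0 < p * q)%N by rewrite muln_gt0 prime_gt0 // part_gt0.
  have := UD_galois_exponent k_inf n_char iota z_prim K_galois K_max pq0 gT sG.
  move/eqP; rewrite -order_dvdn Gauss_dvdl; first by rewrite order_dvdn => /eqP.
  have sp : p.-nat #[s]%g by apply: mem_p_elt (pHall_pgroup PG) sP.
  exact: pnat_coprime sp (part_pnat _ _).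
have := UD_galois_rank k_inf n_char iota z_prim f K_galois p_pr pn (pHall_sub PG) Pp.
by rewrite cP leq_exp2l ?prime_gt1 // leqNgt r3.
Qed.
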